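(* Let $k$ be a field of arbitrary characteristic, $S=k[x_1,\ldots,x_n]$, and let $I\subseteq S$ be a homogeneous ideal. Let $\mathrm{Gin}(I)$ denote the generic initial ideal of $I$ with respect to the reverse lexicographic order. Then for every integer $t$ with $0\le t\le n$: (i) $\mathrm{reg}_t(I)=\mathrm{reg}_t(\mathrm{Gin}(I))$; (ii) $a^*_t(I)=a^*_t(\mathrm{Gin}(I))$.
   Context: $S=k[x_1,\ldots,x_n]$ has the standard grading ($\deg x_i=1$), and $\mathfrak M=(x_1,\ldots,x_n)$. For a finitely generated graded $S$-module $M$, $H^i_{\mathfrak M}(M)$ is the $i$-th local cohomology module of $M$ with respect to $\mathfrak M$, and $a_i(M)=\max\{m\mid H^i_{\mathfrak M}(M)_m\ne 0\}$, with $a_i(M)=-\infty$ if $H^i_{\mathfrak M}(M)=0$. Put $\mathrm{reg}_t(M)=\max\{a_i(M)+i\mid 0\le i\le t\}$ and $a^*_t(M)=\max\{a_i(M)\mid 0\le i\le t\}$. In the claim these are applied to the ideals $I$ and $\mathrm{Gin}(I)$ regarded as graded $S$-modules. The reverse lexicographic order is the graded (degree) reverse lexicographic term order with $x_1>\cdots>x_n$; $\mathrm{in}(J)$ is the ideal generated by the leading monomials of the nonzero elements of $J$. The group $GL(n,k)$ acts on $S$ by graded $k$-algebra automorphisms, $g=(g_{ij})$ sending $x_j$ to $\sum_i g_{ij}x_i$. The generic initial ideal $\mathrm{Gin}(I)$ is the monomial ideal $J\subset S$ for which there is a non-empty Zariski open set $U\subset GL(n,k)$ with $\mathrm{in}(gI)=J$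 for all $g\in U$.
   Formalization: The field k is assumed infinite (of arbitrary characteristic), since over a finite field the ideal Gin(I) defined by a non-empty Zariski open subset of GL(n,k) is not unique and the claim can fail. *)

(* Defs.v *)
From HB Require Import structures.
From mathcomp Require Import all_boot all_order all_algebra.
From mathcomp Require Export mpoly.
From mathcomp Require Import boolp classical_sets constructive_ereal.

Set Implicit Arguments.
Unset Strict Implicit.
Unset Printing Implicit Defensive.

Import Order.TTheory GRing.Theory Num.Theory.

Local Open Scope classical_set_scope.
Local Open Scope ring_scope.

(* The variable x_(j+1) of S = k[x_1, .., x_n] is 'X_j with j : 'I_n. *)

Section Ideals.
Variables (k : fieldType) (n : nat).
Local Notation S := {mpoly k[n]}.

Definition is_ideal (I : set S) : Prop :=
  [/\ I 0, (forall f g, I f -> I g -> I (f + g))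
    & (forall f g, I g -> I (f * g))].

Definition ideal_gen (A : set S) : set S :=
  [set f | forall I : set S, is_ideal I -> A `<=` I -> I f].

Definition monomial_ideal (I : set S) : Prop :=
  exists A : set 'X_{1..n}, I = ideal_gen [set 'X_[m] | m in A].

(* The r-th power of (x_1, .., x_n). *)
Definition max_ideal_pow (r : nat) : set S :=
  ideal_gen [set 'X_[m] | m in [set m : 'X_{1..n} | mdeg m = r]].

Record homogIdeal := HomogIdeal {
  hideal_set :> set S;
  hideal_ideal : is_ideal hideal_set;
  hideal_homog : forall (d : nat) f,
    hideal_set f -> hideal_set (pihomog mdeg d f)
}.

End Ideals.

Section GradedModules.
Variables (k : fieldType) (n : nat).
Local Notation S := {mpoly k[n]}.

(* A Z-graded S-module M, the direct sum of the M_d = gm_deg M d. *)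
Record gradedModule := GradedModule {
  gm_mod :> lmodType S;
  gm_deg : int -> set gm_mod;
  gm_deg0 : forall d, gm_deg d 0;
  gm_degB : forall d x y, gm_deg d x -> gm_deg d y -> gm_deg d (x - y);
  gm_degZ : forall (e : nat) (d : int) (f : S) x,
    f \is e.-homog -> gm_deg d x -> gm_deg (e%:Z + d) (f *: x);
  gm_sum : forall x, exists (r : seq int) (c : int -> gm_mod),
    (forall d, gm_deg d (c d)) /\ x = \sum_(d <- r) c d;
  gm_direct : forall (r : seq int) (c : int -> gm_mod), uniq r ->
    (forall d, gm_deg d (c d)) -> \sum_(d <- r) c d = 0 ->
    forall d, d \in r -> c d = 0
}.

(* Morphisms are the S-linear maps that preserve degrees. *)
Definition graded_hom (M N : gradedModule) (f : M -> N) : Prop :=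
  forall d x, gm_deg d x -> gm_deg d (f x).

Definition graded_injective (E : gradedModule) : Prop :=
  forall (A B : gradedModule) (i : {linear A -> B}) (f : {linear A -> E}),
    graded_hom i -> injective i -> graded_hom f ->
  exists h : {linear B -> E}, graded_hom h /\ forall x, h (i x) = f x.

(* 0 -> M -> E_0 -> E_1 -> .. exact, with injective objects E_i. *)
Record injResolution (M : gradedModule) := InjResolution {
  res_obj : nat -> gradedModule;
  res_aug : {linear M -> res_obj 0};
  res_diff : forall i, {linear res_obj i -> res_obj i.+1};
  res_objP : forall i, graded_injective (res_obj i);
  res_aug_hom : graded_hom res_aug;
  res_diff_hom : forall i, graded_hom (res_diff i);
  res_aug_inj : injective res_aug;
  res_exact0 : forall x, res_diff 0 x = 0 <-> exists y, res_aug y = x;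
  res_exactS : forall i x, res_diff i.+1 x = 0 <-> exists y, res_diff i y = x
}.

(* The elements annihilated by a power of (x_1, .., x_n). *)
Definition torsion (M : gradedModule) : set M :=
  [set x | exists r, forall f, max_ideal_pow r f -> f *: x = 0].

Section Cohomology.
Variables (M : gradedModule) (E : injResolution M).

(* The cocycles of degree d and the coboundaries in position i of the complex *)
(* of torsion submodules of E. *)
Definition lc_cocycle (i : nat) (d : int) : set (res_obj E i) :=
  [set x | [/\ torsion x, gm_deg d x & res_diff E i x = 0]].

Definition lc_coboundary (i : nat) : set (res_obj E i) :=
  match i with
  | 0 => [set 0]
  | j.+1 => [set res_diff E j y | y in @torsion (res_obj E j)]
  end.

End Cohomology.

Arguments lc_cocycle {M} E i d _.
Arguments lc_coboundary {M} E i _.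

(* The degree d part of the i-th local cohomology module of M, the i-th right *)
(* derived functor of the torsion functor on graded modules, is nonzero.  It *)
(* does not depend on the resolution. *)
Definition lc_neq0 (M : gradedModule) (i : nat) (d : int) : Prop :=
  exists E : injResolution M, ~ (lc_cocycle E i d `<=` lc_coboundary E i).

(* The largest element, with -oo for the empty set; +oo for a nonempty set *)
(* without largest element, which does not arise from finitely generated M. *)
Definition max_int (A : set int) : \bar int :=
  match pselect (exists m, A m /\ forall d, A d -> d <= m) with
  | left H => (projT1 (cid H))%:E%E
  | right _ => if A == set0 then -oo%E else +oo%E
  end.

Definition a_inv (M : gradedModule) (i : nat) : \bar int :=
  max_int [set d | lc_neq0 M i d].

Definition reg_upto (M : gradedModule) (t : nat) : \bar int :=
  (\big[maxe/-oo]_(i < t.+1) (a_inv M i + i%:Z%:E))%E.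

Definition a_star (M : gradedModule) (t : nat) : \bar int :=
  (\big[maxe/-oo]_(i < t.+1) a_inv M i)%E.

End GradedModules.

Section IdealModule.
Variables (k : fieldType) (n : nat) (I : homogIdeal k n).
Local Notation S := {mpoly k[n]}.

Definition hideal_pred : {pred S^o} := fun f : S => `[< hideal_set I f >].

Fact hideal_submod_closed : submod_closed hideal_pred.
Proof.
have [I0 ID IM] := hideal_ideal I.
split=> [|f g h]; first exact/asboolP.
by move=> /asboolP Ig /asboolP Ih; apply/asboolP/ID => //; apply: IM.
Qed.

HB.instance Definition _ :=
  GRing.isSubmodClosed.Build S S^o hideal_pred hideal_submod_closed.

Record ideal_elt := IdealElt { ideal_val : S^o; _ : ideal_val \in hideal_pred }.

HB.instance Definition _ := [isSub for ideal_val].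
HB.instance Definition _ := [Choice of ideal_elt by <:].
HB.instance Definition _ := [SubChoice_isSubLmodule of ideal_elt by <:].

Definition ideal_deg (d : int) : set ideal_elt :=
  [set x | match d with
           | Posz e => (ideal_val x : S) \is e.-homog
           | Negz _ => x = 0
           end].

Fact ideal_deg0 d : ideal_deg d 0.
Proof. by case: d => e //=; apply: dhomog0. Qed.

Fact ideal_degB d x y : ideal_deg d x -> ideal_deg d y -> ideal_deg d (x - y).
Proof.
case: d => e /=; first exact: rpredB.
by move=> -> ->; rewrite subrr.
Qed.

Fact ideal_degZ (e : nat) (d : int) (f : S) (x : ideal_elt) :
  f \is e.-homog -> ideal_deg d x -> ideal_deg (e%:Z + d) (f *: x).
Proof.
move=> hf; case: d => d /=; first exact: dhomogM.
by move=> ->; rewrite scaler0; apply: ideal_deg0.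
Qed.

Fact ideal_sum (x : ideal_elt) : exists (r : seq int) (c : int -> ideal_elt),
  (forall d, ideal_deg d (c d)) /\ x = \sum_(d <- r) c d.
Proof.
have xI e : pihomog mdeg e (val x : S) \in hideal_pred.
  by apply/asboolP/hideal_homog/asboolP; case: x.
exists [seq Posz e | e <- iota 0 (mmeasure mdeg (val x : S))].
exists (fun d => if d is Posz e then IdealElt (xI e) else 0); split.
  by case=> e //=; apply: pihomogP.
apply: val_inj; rewrite big_map raddf_sum /=.
rewrite [LHS](@pihomog_partitionE _ _ mdeg _ _ (leqnn _)).
by rewrite -(big_mkord predT (fun d => pihomog mdeg d _)) /index_iota subn0.
Qed.

Fact ideal_direct (r : seq int) (c : int -> ideal_elt) : uniq r ->
  (forall d, ideal_deg d (c d)) -> \sum_(d <- r) c d = 0 ->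
  forall d, d \in r -> c d = 0.
Proof.
move=> ur hc c0 [] e er; last exact: (hc (Negz e)).
apply: val_inj; move/(congr1 val): c0; rewrite raddf_sum.
move=> /(congr1 (fun f : S^o => pihomog mdeg e (f : S))).
rewrite raddf_sum (bigD1_seq (Posz e)) //= raddf0.
rewrite pihomog_dE ?(hc (Posz e)) // big1 ?addr0 // => -[] e' ne.
  by rewrite (pihomog_ne0 _ (hc (Posz e'))) //; apply: contra ne => /eqP->.
by rewrite (hc (Negz e')) raddf0.
Qed.

Definition ideal_module : gradedModule k n :=
  GradedModule ideal_deg0 ideal_degB ideal_degZ ideal_sum ideal_direct.

End IdealModule.

Section GenericInitialIdeal.
Variables (k : fieldType) (n : nat).
Local Notation S := {mpoly k[n]}.

(* Graded reverse lexicographic order, x_1 > .. > x_n: among monomials of the *)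
(* same degree, the smaller one has the larger exponent at the last *)
(* variable where they differ. *)
Definition revlex_lt (m1 m2 : 'X_{1..n}) : Prop :=
  (mdeg m1 < mdeg m2)%N \/
  mdeg m1 = mdeg m2 /\
    exists i : 'I_n, (m2 i < m1 i)%N /\
      forall j : 'I_n, (i < j)%N -> m1 j = m2 j.

Definition is_lead_monom (f : S) (m : 'X_{1..n}) : Prop :=
  m \in msupp f /\ forall m', m' \in msupp f -> m' != m -> revlex_lt m' m.

Definition initial_ideal (I : set S) : set S :=
  ideal_gen [set 'X_[m] | m in [set m | exists2 f, I f & is_lead_monom f m]].

Definition gl_act (g : 'M[k]_n) (f : S) : S :=
  f \mPo [tuple \sum_(i < n) g i j *: 'X_i | j < n].

(* The Zariski topology of GL(n,k) is induced by the affine space of matrices, *)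
(* with one coordinate for each of the n * n entries. *)
Definition GL_zariski_open (U : set 'M[k]_n) : Prop :=
  exists F : set {mpoly k[n * n]}, U =
    [set g | g \in unitmx /\
      exists2 p, F p & p.@[fun i => mxvec g 0 i] != 0].

Definition is_gin (I J : set S) : Prop :=
  monomial_ideal J /\
  exists U : set 'M[k]_n, [/\ GL_zariski_open U, U !=set0
    & forall g, U g -> initial_ideal [set gl_act g f | f in I] = J].

End GenericInitialIdeal.

(* Main.v *)
(* For linear forms z_1, .., z_n spanning S_1 and an injective resolution E,
   the elements of E (or of its torsion part) killed by z_1, .., z_j form
   complexes on which z_(j+1) is surjective, since injective graded modules
   are divisible. The long exact sequences of multiplication by z_(j+1) show
   that vanishing of H^i_M(I) in degrees > c_i for all i <= t, where c_i <=
   c_(i+1) + 1, is equivalent to vanishing of Ext^i(k, I) in the same degrees.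
   If the z_j are moreover filter-regular on S/I, the same sequences, started
   from I itself, turn this into conditions on the colons (I + (z_1, .., z_j))
   : z_(j+1). Taking c_i = c - i and c_i = c gives reg_t and a*_t.

   For the last variables z_j = x_(n-j+1), these colons agree degree by degree
   for gI and for in(gI) under the reverse lexicographic order. So it suffices
   to find g in the given open set for which x_n, .., x_1 is filter-regular on
   S/gI; prime avoidance, by Noetherian induction on I, does this over an
   infinite field. *)

Require Import Defs.
From HB Require Import structures.
From mathcomp Require Import all_boot all_order all_algebra.
From mathcomp Require Import zify ring.
From mathcomp Require Import boolp classical_sets functions constructive_ereal.

Set Implicit Arguments.
Unset Strict Implicit.
Unset Printing Implicit Defensive.

Import Order.TTheory GRing.Theory Num.Theory.

Local Open Scope classical_set_scope.
Local Open Scope ring_scope.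

(** * Graded modules *)

(** [lc_neq0] is existential over injective resolutions. One resolution is built from graded modules
    Hom_k(S, M), so that vanishing has content; that every resolution gives the same answer is read
    off from the criterion, whose final conditions on M do not mention the resolution. The bounds
    satisfy c_i <= c_(i+1) + 1 because the connecting maps raise i and lower the degree by one.

    The sequences started from I give regularity of z_(j+1) on I/(z_1, .., z_j)I, not on S/(I +
    (z_1, .., z_j)). The bridge is Tor_1(S/I, S/Q) = (I meet Q)/QI for Q = (z_1, .., z_j). For t = n
    the last term I/(x_1, .., x_n)I has no colon of its own: it adds the last colon condition and,
    in degree 0, the question whether I = 0.

    Since the colons agree degree by degree, filter-regularity passes from gI to the initial ideal,
    in every characteristic. The open set constrains g, whereas the linear forms to be chosen are
    columns of the inverse of g; hence the search runs over a matrix h with g a multiple of its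
    adjugate. *)

Section HomogeneousSums.
Variables (V : zmodType) (P : int -> set V).
Hypothesis P0 : forall d, P d 0.
Hypothesis PB : forall d x y, P d x -> P d y -> P d (x - y).

(** Stated for an arbitrary family P because it serves twice: for graded modules, and to cut a
    graded module out of all functions from S to M, where the homogeneous functions do not span. *)
Definition homsum (x : V) : Prop :=
  exists2 l : seq V, (forall y, y \in l -> exists d, P d y) & x = \sum_(y <- l) y.

Lemma homN d x : P d x -> P d (- x).
Proof. by move=> Px; rewrite -sub0r; apply: PB. Qed.

Lemma homD d x y : P d x -> P d y -> P d (x + y).
Proof. by move=> Px Py; rewrite -[y]opprK; apply/PB/homN. Qed.

Lemma homsum0 : homsum 0.
Proof. by exists [::] => //; rewrite big_nil. Qed.

Lemma homsum_hom d x : P d x -> homsum x.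
Proof.
move=> Px; exists [:: x]; last by rewrite big_seq1.
by move=> y; rewrite inE => /eqP ->; exists d.
Qed.

Lemma homsumD x y : homsum x -> homsum y -> homsum (x + y).
Proof.
move=> [l hl ->] [l' hl' ->]; exists (l ++ l'); last by rewrite big_cat.
by move=> z; rewrite mem_cat => /orP[/hl|/hl'].
Qed.

Lemma homsumN x : homsum x -> homsum (- x).
Proof.
move=> [l hl ->]; exists [seq - y | y <- l]; last by rewrite big_map sumrN.
by move=> y /mapP[z /hl[d Pz] ->]; exists d; exact: homN.
Qed.

Lemma homsum_sum (I : Type) (r : seq I) (Q : pred I) (F : I -> V) :
  (forall i, homsum (F i)) -> homsum (\sum_(i <- r | Q i) F i).
Proof.
by move=> h; elim/big_rec: _ => [|i x _ Px]; [exact: homsum0|exact: homsumD].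
Qed.

Lemma homsum_decomp x : homsum x ->
  exists c : int -> V, (forall d, P d (c d)) /\
  exists r : seq int,
    [/\ uniq r, forall d, d \notin r -> c d = 0 & x = \sum_(d <- r) c d].
Proof.
move=> [l + ->]; elim: l => [|y l IH] hl.
  exists (fun _ => 0); split=> [d|]; first exact: P0.
  by exists [::]; split=> //; rewrite !big_nil.
have [|c [cP [r [ur r0 rE]]]] := IH.
  by move=> z zl; apply: hl; rewrite inE zl orbT.
have [d Py] := hl y (mem_head _ _).
exists (fun e => if e == d then y + c d else c e); split.
  by move=> e; case: eqP => [->|_]; [exact: homD|exact: cP].
pose r' := if d \in r then r else d :: r.
have ur' : uniq r' by rewrite /r'; case: ifP => //= ->.
have dr' : d \in r' by rewrite /r'; case: ifP => // _; rewrite mem_head.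
have rr' e : e \in r -> e \in r'.
  by rewrite /r'; case: ifP => // _ er; rewrite inE er orbT.
exists r'; split => //.
  move=> e er'; case: eqP => [ed|_]; first by rewrite ed dr' in er'.
  by apply: r0; apply: contra er' => /rr'.
rewrite big_cons rE [RHS](bigD1_seq d) //= eqxx -addrA; congr (_ + _).
have -> : \sum_(e <- r) c e = \sum_(e <- r') c e.
  rewrite /r'; case: ifP => // dr; rewrite big_cons r0 ?add0r //.
  by rewrite dr.
rewrite (bigD1_seq d) //=; congr (_ + _).
by apply: eq_bigr => e /negPf ->.
Qed.

End HomogeneousSums.

Section GradedComponents.
Variables (k : fieldType) (n : nat).
Local Notation S := {mpoly k[n]}.
Implicit Types M N : gradedModule k n.

Lemma gm_homsum M (x : M) : homsum (@gm_deg k n M) x.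
Proof.
have [r [c [hc ->]]] := gm_sum x.
have h d : homsum (@gm_deg k n M) (c d) by apply: homsum_hom; exact: hc.
exact: homsum_sum.
Qed.

(** [gm_sum] allows repeated degrees and leaves c arbitrary outside r. This normalised choice is
    what yields a component function. *)
Fact gcomp_key M (x : M) :
  {c : int -> M | (forall d, gm_deg d (c d)) /\
  exists r : seq int,
    [/\ uniq r, forall d, d \notin r -> c d = 0 & x = \sum_(d <- r) c d]}.
Proof.
by apply/cid/homsum_decomp/gm_homsum; [exact: gm_deg0|exact: gm_degB].
Qed.

Definition gcomp M (d : int) (x : M) : M := sval (gcomp_key x) d.

Lemma gcompP M d (x : M) : gm_deg d (gcomp d x).
Proof. by rewrite /gcomp; case: (gcomp_key x) => c /= [hc _]; exact: hc. Qed.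

Lemma gcomp_sum M (x : M) : exists r : seq int,
  [/\ uniq r, forall d, d \notin r -> gcomp d x = 0
    & x = \sum_(d <- r) gcomp d x].
Proof. by rewrite /gcomp; case: (gcomp_key x) => c /= [_ hc]; exact: hc. Qed.

Lemma gm_degD M d (x y : M) : gm_deg d x -> gm_deg d y -> gm_deg d (x + y).
Proof. by apply: homD; [exact: gm_deg0|exact: gm_degB]. Qed.

Lemma big_superset (V : zmodType) (r s : seq int) (c : int -> V) :
  uniq r -> uniq s -> {subset r <= s} -> (forall d, d \notin r -> c d = 0) ->
  \sum_(d <- r) c d = \sum_(d <- s) c d.
Proof.
move=> ur us rs r0; rewrite [RHS](bigID (fun d => d \in r)) /=.
rewrite [X in _ + X]big1 ?addr0; last by move=> d; exact: r0.
rewrite -[RHS]big_filter; apply: perm_big; apply: uniq_perm => //.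
  by rewrite filter_uniq.
by move=> d; rewrite mem_filter; case: (boolP (d \in r)) => //= /rs ->.
Qed.

Lemma gcomp_unique M (x : M) (c : int -> M) (r : seq int) d :
  (forall e, gm_deg e (c e)) -> (forall e, e \notin r -> c e = 0) ->
  x = \sum_(e <- undup r) c e -> gcomp d x = c d.
Proof.
move=> cP r0 xE; have [s [us s0 xE']] := gcomp_sum x.
pose q := undup (r ++ s).
have uq : uniq q by exact: undup_uniq.
have /(gm_direct uq) E : forall e, gm_deg e (gcomp e x - c e).
  by move=> e; apply: gm_degB; [exact: gcompP|exact: cP].
apply/eqP; rewrite -subr_eq0; apply/eqP.
have [dq|] := boolP (d \in q); last first.
  by rewrite mem_undup mem_cat negb_or => /andP[/r0 -> /s0 ->]; rewrite subrr.
apply: E => //; rewrite sumrB.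
rewrite -(@big_superset _ s q) //; last first.
  by move=> e es; rewrite mem_undup mem_cat es orbT.
rewrite -(@big_superset _ (undup r) q) ?undup_uniq //.
- by rewrite -xE -xE' subrr.
- by move=> e; rewrite !mem_undup mem_cat => ->.
- by move=> e; rewrite mem_undup; exact: r0.
Qed.

Lemma gcompD M d : {morph @gcomp M d : x y / x + y}.
Proof.
move=> x y; have [r [ur r0 xE]] := gcomp_sum x.
have [s [us s0 yE]] := gcomp_sum y.
apply: (@gcomp_unique _ _ (fun d => gcomp d x + gcomp d y) (r ++ s)).
- by move=> e; apply: gm_degD; exact: gcompP.
- by move=> e; rewrite mem_cat negb_or => /andP[/r0 -> /s0 ->]; rewrite addr0.
- rewrite big_split /= {1}xE {1}yE; congr (_ + _).
    apply: big_superset; rewrite ?undup_uniq // => e er.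
    by rewrite mem_undup mem_cat er.
  apply: big_superset; rewrite ?undup_uniq // => e es.
  by rewrite mem_undup mem_cat es orbT.
Qed.

Lemma gcomp_hom M d e (x : M) :
  gm_deg d x -> gcomp e x = if e == d then x else 0.
Proof.
move=> hx; apply: (@gcomp_unique _ _ (fun e => if e == d then x else 0) [:: d]).
- by move=> e'; case: eqP => [->|_] //; exact: gm_deg0.
- by move=> e'; rewrite inE => /negPf ->.
- by rewrite big_seq1 eqxx.
Qed.

Lemma gcomp_id M d (x : M) : gm_deg d x -> gcomp d x = x.
Proof. by move/gcomp_hom ->; rewrite eqxx. Qed.

Lemma gcomp0 M d : @gcomp M d 0 = 0.
Proof. by rewrite (@gcomp_hom M 0 d 0 (gm_deg0 M 0)) if_same. Qed.

Lemma gcomp_bigsum M d (I : Type) (r : seq I) (P : pred I) (F : I -> M) :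
  gcomp d (\sum_(i <- r | P i) F i) = \sum_(i <- r | P i) gcomp d (F i).
Proof. by apply: (big_morph (@gcomp M d) (@gcompD M d) (gcomp0 M d)). Qed.

Lemma gcompZ M (e : nat) (d : int) (f : S) (x : M) :
  f \is e.-homog -> gcomp (e%:Z + d) (f *: x) = f *: gcomp d x.
Proof.
move=> hf; have [r [ur r0 xE]] := gcomp_sum x.
rewrite {1}xE scaler_sumr gcomp_bigsum.
have E i : gcomp (e%:Z + d) (f *: gcomp i x) =
    if i == d then f *: gcomp i x else 0.
  rewrite (@gcomp_hom _ (e%:Z + i)).
    by rewrite (inj_eq (addrI _)) eq_sym.
  by apply: gm_degZ => //; exact: gcompP.
under eq_bigr do rewrite E; rewrite -big_mkcond /=.
have [dr|dr] := boolP (d \in r).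
  by rewrite -big_filter filter_pred1_uniq // big_seq1.
rewrite r0 // scaler0 big_seq_cond big1 // => i /andP[ir /eqP id].
by rewrite id (negPf dr) in ir.
Qed.

Lemma gcomp_graded_hom M N (f : {linear M -> N}) d x :
  graded_hom f -> gcomp d (f x) = f (gcomp d x).
Proof.
move=> hf; have [r [ur r0 xE]] := gcomp_sum x.
rewrite {1}xE linear_sum; apply: (@gcomp_unique _ _ (fun d => f (gcomp d x)) r).
- by move=> e; apply/hf/gcompP.
- by move=> e /r0 ->; rewrite linear0.
- by rewrite undup_id.
Qed.

End GradedComponents.

(** * Injective resolutions *)

Section LinearExtension.
Variables (k : fieldType) (n : nat).
Local Notation S := {mpoly k[n]}.

(** The k-structure of an S-module is present only through the constant polynomials. *)
Definition klinear (U V : lmodType S) (f : U -> V) : Prop :=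
  forall (c : k) x y, f (c%:MP *: x + y) = c%:MP *: f x + f y.

Section KLinearTheory.
Variables (U V : lmodType S) (f : U -> V).
Hypothesis lf : klinear f.

Lemma klinearD x y : f (x + y) = f x + f y.
Proof. by have := lf 1 x y; rewrite mpolyC1 !scale1r. Qed.

Lemma klinear0 : f 0 = 0.
Proof. by apply: (addrI (f 0)); rewrite -klinearD !addr0. Qed.

Lemma klinear_sum (I : Type) (r : seq I) (P : pred I) (F : I -> U) :
  f (\sum_(i <- r | P i) F i) = \sum_(i <- r | P i) f (F i).
Proof. by apply: (big_morph f klinearD klinear0). Qed.

End KLinearTheory.

Lemma mpolyC_homog (c : k) : (c%:MP : S) \is 0.-homog.
Proof. by rewrite -[c%:MP]mulr1 mul_mpolyC; apply/dhomogZ/dhomog1. Qed.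

Lemma gcompZk (M : gradedModule k n) d (c : k) (x : M) :
  gcomp d (c%:MP *: x) = c%:MP *: gcomp d x.
Proof. by rewrite -{1}[d]add0r (@gcompZ _ _ _ 0) ?mpolyC_homog. Qed.

Variables (A B M : gradedModule k n) (i : {linear A -> B}) (l : A -> M).
Hypotheses (i_inj : injective i) (i_hom : graded_hom i).
Hypotheses (l_lin : klinear l)
  (l_hom : forall d x, gm_deg d x -> gm_deg d (l x)).

Let G0 : set (B * M) := [set x | exists a, x = (i a, l a)].

(** Graphs of partial k-linear maps: the second clause makes them single-valued, the third makes the
    domain graded and the map degree-preserving. *)
Let good (G : set (B * M)) : Prop :=
  [/\ forall (c : k) x y, G x -> G y ->
        G (c%:MP *: x.1 + y.1, c%:MP *: x.2 + y.2),
      forall m, G (0, m) -> m = 0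
    & forall d x, G x -> G (gcomp d x.1, gcomp d x.2)].

Let l_gcomp d x : gcomp d (l x) = l (gcomp d x).
Proof.
have [r [ur r0 xE]] := gcomp_sum x.
rewrite {1}xE (klinear_sum l_lin).
apply: (@gcomp_unique _ _ _ _ (fun d => l (gcomp d x)) r).
- by move=> e; apply/l_hom/gcompP.
- by move=> e /r0 ->; rewrite (klinear0 l_lin).
- by rewrite undup_id.
Qed.

Let good_G0 : good G0.
Proof.
split=> [c x y [a ->] [b ->]|m [a [/esym ia ->]]|d x [a ->]] /=.
- by exists (c%:MP *: a + b); rewrite linearP l_lin.
- have -> : a = 0 by apply: i_inj; rewrite linear0.
  exact: klinear0.
- by exists (gcomp d a); rewrite gcomp_graded_hom // l_gcomp.
Qed.

Let maximal_good : exists G, [/\ good G, G0 `<=` G &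
  forall G', good G' -> G `<=` G' -> G' `<=` G].
Proof.
(* Zorn is applied to the sets G with [G0] union G good, so that the empty chain is covered as well:
   its union is empty and [G0] is good. *)
have [F FP Ftot|G [Ggood Gmax]] :=
    @Zorn_bigcup _ [set G : set (B * M) | good (G0 `|` G)].
  pose U := G0 `|` \bigcup_(X in F) X.
  have common x y : U x -> U y -> exists H, [/\ good H, H x, H y & H `<=` U].
    have sub X : F X -> G0 `|` X `<=` U by move=> FX; apply: setUS => z Xz; exists X.
    move=> [G0x|[X FX Xx]] [G0y|[Y FY Yy]].
    - by exists G0; split=> // z; left.
    - by exists (G0 `|` Y); split; [exact: FP|left|right|exact: sub].
    - by exists (G0 `|` X); split; [exact: FP|right|left|exact: sub].
    - have [XY|YX] := Ftot _ _ FX FY.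
        by exists (G0 `|` Y); split; [exact: FP|right; exact: XY|right|exact: sub].
      by exists (G0 `|` X); split; [exact: FP|right|right; exact: YX|exact: sub].
  split=> [c x y Ux Uy|m Ux|d x Ux].
  - by have [H [[H1 _ _] Hx Hy]] := common _ _ Ux Uy; apply; exact: H1.
  - by have [H [[_ H2 _] Hx _ _]] := common _ _ Ux Ux; exact: H2.
  - by have [H [[_ _ H3] Hx _]] := common _ _ Ux Ux; apply; exact: H3.
exists (G0 `|` G); split; [exact: Ggood|exact: subsetUl|].
move=> G' gG' sG; apply: contrapT => nsG'.
apply: (Gmax G'); last first.
  suff E : G0 `|` G' = G' by rewrite /= E.
  apply/seteqP; split; last exact: subsetUr.
  by move=> x [G0x|//]; apply: sG; left.
split; first by apply: subset_trans sG; exact: subsetUr.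
by move=> sG'; apply: nsG'; apply: subset_trans sG' _; exact: subsetUr.
Qed.

(** Graded vector spaces over a field are injective. A maximal graph is total because it can
    otherwise be enlarged by one homogeneous vector. *)
Lemma klinear_extension : exists m : B -> M,
  [/\ klinear m, forall d x, gm_deg d x -> gm_deg d (m x)
    & forall a, m (i a) = l a].
Proof.
have [G [[Glin Gfun Ghom] sG Gmax]] := maximal_good.
have G00 : G (0, 0).
  by apply: sG; exists 0; rewrite linear0 (klinear0 l_lin).
have Guniq b m m' : G (b, m) -> G (b, m') -> m = m'.
  move=> h h'; apply/eqP; rewrite -subr_eq0; apply/eqP/Gfun.
  have := Glin (-1) _ _ h' h; rewrite /= mpolyCN mpolyC1 !scaleN1r addNr.
  by rewrite addrC.
have Gtot_hom d b : gm_deg d b -> exists m, G (b, m).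
  move=> hb; apply: contrapT => nb.
  (* The extension by b |-> 0. Homogeneity of b keeps the enlarged domain graded. *)
  pose G' : set (B * M) := [set x | exists c b', x.1 = b' + c%:MP *: b /\ G (b', x.2)].
  suff /Gmax : good G'.
    have sG' : G `<=` G'.
      by move=> -[b' m] Gx; exists 0, b'; rewrite mpolyC0 scale0r addr0.
    move=> /(_ sG' (b, 0)) Gb; apply: nb; exists 0; apply: Gb.
    by exists 1, 0; rewrite mpolyC1 scale1r add0r.
  split.
  - move=> c [x1 x2] [y1 y2] [cx [x' /= [-> Gx]]] [cy [y' /= [-> Gy]]].
    exists (c * cx + cy), (c%:MP *: x' + y'); split.
      rewrite mpolyCD mpolyCM scalerDl scalerDr scalerA -!addrA; congr (_ + _).
      by rewrite addrCA.
    exact: (Glin c _ _ Gx Gy).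
  - move=> m [c [b' /= [/esym/eqP + Gb']]].
    have [->|c0] := eqVneq c 0.
      rewrite mpolyC0 scale0r addr0 => /eqP b'0.
      by apply: Gfun; rewrite -b'0.
    rewrite addr_eq0 => /eqP b'E; case: nb; exists (- c^-1%:MP *: m).
    have := Glin (- c^-1) _ _ Gb' G00.
    rewrite /= !addr0 b'E scalerN mpolyCN scaleNr opprK scalerA -mpolyCM.
    by rewrite mulVf // mpolyC1 scale1r.
  - move=> e [x1 x2] [c [b' /= [-> Gb']]].
    exists (if e == d then c else 0), (gcomp e b'); split; last exact: (Ghom e _ Gb').
    rewrite gcompD gcompZk (gcomp_hom e hb); congr (_ + _).
    by case: eqP => // _; rewrite scaler0 mpolyC0 scale0r.
have GD x y : G x -> G y -> G (x.1 + y.1, x.2 + y.2).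
  by move=> Gx Gy; have := Glin 1 _ _ Gx Gy; rewrite mpolyC1 !scale1r.
have Gtot b : exists m, G (b, m).
  have [r [_ _ ->]] := gcomp_sum b.
  elim/big_rec: _ => [|d x _ [m Gm]]; first by exists 0.
  have [m' Gm'] := Gtot_hom d _ (gcompP d b).
  by exists (m' + m); apply: (GD _ _ Gm' Gm).
have /choice[m mP] := Gtot.
exists m; split.
- by move=> c x y; apply: (Guniq _ _ _ (mP _)); apply: (Glin c _ _ (mP x) (mP y)).
- move=> d x hx; rewrite (_ : m x = gcomp d (m x)); first exact: gcompP.
  apply: (Guniq _ _ _ (mP _)).
  by have := Ghom d _ (mP x); rewrite /= gcomp_id.
- by move=> a; apply: (Guniq _ _ _ (mP _)); apply: sG; exists a.
Qed.

End LinearExtension.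

(** * Coinduced modules and their cokernels *)

Section FunctionModules.
Variables (k : fieldType) (n : nat) (M : gradedModule k n).
Local Notation S := {mpoly k[n]}.

Definition hom_fun (d : int) : set (S -> M) :=
  [set f | klinear (f : S^o -> M) /\
    forall (e : nat) (s : S), s \is e.-homog -> gm_deg (e%:Z + d) (f s)].

(** Common interface of two S-modules of functions from S to M, the coinduced module and its
    cokernel: they differ only in the action and in the homogeneous parts, and the module axioms
    hold only on suitable functions. *)
Record actionData := ActionData {
  ad_deg : int -> set (S -> M);
  ad_act : S -> (S -> M) -> (S -> M);
  ad_deg0 : forall d, ad_deg d 0;
  ad_degB : forall d f g, ad_deg d f -> ad_deg d g -> ad_deg d (f - g);
  ad_degS : forall d f, ad_deg d f -> hom_fun d f;
  ad_actA : forall s t f, klinear (f : S^o -> M) ->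
    ad_act s (ad_act t f) = ad_act (s * t) f;
  ad_act1 : forall d f, ad_deg d f -> ad_act 1 f = f;
  ad_actDr : forall s f g, ad_act s (f + g) = ad_act s f + ad_act s g;
  ad_actDl : forall s t f, klinear (f : S^o -> M) ->
    ad_act (s + t) f = ad_act s f + ad_act t f;
  ad_actP : forall (e : nat) d s f,
    s \is e.-homog -> ad_deg d f -> ad_deg (e%:Z + d) (ad_act s f)
}.

Lemma homsum_klinear (D : actionData) f :
  homsum (ad_deg D) f -> klinear (f : S^o -> M).
Proof.
move=> [l hl ->] c x y.
elim: l hl => [|g l IH] hl; first by rewrite !big_nil /= scaler0 addr0.
rewrite !big_cons; have [d /ad_degS[lg _]] := hl g (mem_head _ _).
rewrite /= [LHS]/GRing.add /= [in RHS]/GRing.add /=.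
rewrite lg IH; last by move=> h hh; apply: hl; rewrite inE hh orbT.
by rewrite scalerDr addrACA.
Qed.

Section Module.
Variable D : actionData.

Definition fun_pred : {pred S -> M} := fun f => `[< homsum (ad_deg D) f >].

Fact fun_zmod_closed : zmod_closed fun_pred.
Proof.
split=> [|f g]; first exact/asboolP/homsum0.
move=> /asboolP hf /asboolP hg; apply/asboolP/homsumD => //.
by apply: homsumN => //; [exact: ad_deg0|exact: ad_degB].
Qed.

HB.instance Definition _ :=
  GRing.isZmodClosed.Build (S -> M) fun_pred fun_zmod_closed.

Record fun_elt := FunElt { fun_val : S -> M; _ : fun_val \in fun_pred }.

HB.instance Definition _ := [isSub for fun_val].
HB.instance Definition _ := [Choice of fun_elt by <:].
HB.instance Definition _ := [SubChoice_isSubZmodule of fun_elt by <:].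

Lemma fun_valP (x : fun_elt) : homsum (ad_deg D) (fun_val x).
Proof. by case: x => f hf; apply/asboolP. Qed.

Lemma fun_val_klinear (x : fun_elt) : klinear (fun_val x : S^o -> M).
Proof. exact/homsum_klinear/fun_valP. Qed.

Lemma act_sum s (I : Type) (r : seq I) (F : I -> S -> M) :
  ad_act D s (\sum_(i <- r) F i) = \sum_(i <- r) ad_act D s (F i).
Proof.
apply: (big_morph (ad_act D s)); first exact: ad_actDr.
by apply: (addrI (ad_act D s 0)); rewrite -ad_actDr !addr0.
Qed.

Lemma act_sum_l (I : Type) (r : seq I) (F : I -> S) f :
  klinear (f : S^o -> M) ->
  ad_act D (\sum_(i <- r) F i) f = \sum_(i <- r) ad_act D (F i) f.
Proof.
move=> lf; apply: (big_morph (fun s => ad_act D s f)).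
  by move=> s t; exact: ad_actDl.
by apply: (addrI (ad_act D 0 f)); rewrite -ad_actDl // !addr0.
Qed.

Lemma act_closed s (x : fun_elt) : ad_act D s (fun_val x) \in fun_pred.
Proof.
apply/asboolP; have [l hl ->] := fun_valP x.
rewrite act_sum big_seq_cond; elim/big_rec: _ => [|f g /andP[fl _] hg].
  exact: homsum0.
apply: homsumD => //; have [d hf] := hl f fl.
rewrite (pihomog_partitionE (leqnn (mmeasure mdeg s))).
rewrite act_sum_l; last by case: (ad_degS hf).
apply: homsum_sum => e; apply: (@homsum_hom _ _ (e%:Z + d)).
by apply: ad_actP => //; exact: pihomogP.
Qed.

Definition fun_scale s x : fun_elt := FunElt (act_closed s x).

Fact fun_scaleA s t x : fun_scale s (fun_scale t x) = fun_scale (s * t) x.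
Proof. by apply/val_inj/ad_actA/fun_val_klinear. Qed.

Fact fun_scale1 : left_id 1 fun_scale.
Proof.
move=> x; apply/val_inj => /=; have [l hl ->] := fun_valP x.
rewrite act_sum; apply: eq_big_seq => f /hl[d hf]; exact: ad_act1 hf.
Qed.

Fact fun_scaleDr : right_distributive fun_scale +%R.
Proof. by move=> s x y; apply/val_inj/ad_actDr. Qed.

Fact fun_scaleDl x : {morph fun_scale^~ x : s t / s + t}.
Proof. by move=> s t; apply/val_inj/ad_actDl/fun_val_klinear. Qed.

HB.instance Definition _ := GRing.Zmodule_isLmodule.Build S fun_elt
  fun_scaleA fun_scale1 fun_scaleDr fun_scaleDl.

Definition fun_deg (d : int) : set fun_elt := [set x | ad_deg D d (fun_val x)].

Fact fun_deg_sum (x : fun_elt) : exists (r : seq int) (c : int -> fun_elt),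
  (forall d, fun_deg d (c d)) /\ x = \sum_(d <- r) c d.
Proof.
have [c [hc [r [_ _ xE]]]] := homsum_decomp (ad_deg0 D) (@ad_degB D) (fun_valP x).
have cP d : c d \in fun_pred by apply/asboolP; apply: homsum_hom (hc d).
exists r, (fun d => FunElt (cP d)); split; first exact: hc.
by apply: val_inj; rewrite raddf_sum.
Qed.

Fact fun_deg_direct (r : seq int) (c : int -> fun_elt) : uniq r ->
  (forall d, fun_deg d (c d)) -> \sum_(d <- r) c d = 0 ->
  forall d, d \in r -> c d = 0.
Proof.
move=> ur hc c0 d dr; apply: val_inj; apply: funext => s /=.
have ld := fun_val_klinear (c d).
(* At an argument of degree e the values of the summands lie in the distinct degrees d + e of M,
   where directness of M applies. *)
rewrite (pihomog_partitionE (leqnn (mmeasure mdeg s))).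
rewrite (klinear_sum ld) big1 // => -[e /= _] _.
have he := pihomogP mdeg e s; move: (pihomog _ _ _) he => {}s he.
have h e' : gm_deg e' (fun_val (c (e' - e%:Z)) s).
  by have [_ /(_ _ _ he)] := ad_degS (hc (e' - e%:Z)); rewrite addrC subrK.
have u : uniq [seq d + e%:Z | d <- r] by rewrite map_inj_uniq //; exact: addIr.
have := gm_direct u h; move=> /(_ _ (d + e%:Z)); rewrite addrK.
apply; last exact: map_f.
rewrite big_map; under eq_bigr do rewrite addrK.
transitivity (fun_val (\sum_(d <- r) c d) s); last by rewrite c0.
elim: (r) => [|i l IH]; first by rewrite !big_nil.
by rewrite !big_cons IH.
Qed.

Definition fun_module : gradedModule k n.
Proof.
refine (@GradedModule k n fun_elt fun_deg _ _ _ fun_deg_sum fun_deg_direct).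
- exact: ad_deg0.
- by move=> d x y; exact: ad_degB.
- by move=> e d f x; exact: ad_actP.
Defined.

End Module.

Lemma hom_fun0 d : hom_fun d 0.
Proof.
split=> [c x y|e s _]; first by rewrite /= scaler0 addr0.
exact: gm_deg0.
Qed.

Lemma hom_funB d f g : hom_fun d f -> hom_fun d g -> hom_fun d (f - g).
Proof.
move=> [lf hf] [lg hg]; split=> [c x y|e s hs].
  change (f (c%:MP *: x + y) - g (c%:MP *: x + y) =
    c%:MP *: (f x - g x) + (f y - g y)).
  by rewrite lf lg scalerBr opprD addrACA.
by apply: gm_degB; [exact: hf|exact: hg].
Qed.

Definition coind_act (s : S) (f : S -> M) : S -> M := fun t => f (t * s).

Lemma klin_mulr (f : S -> M) s : klinear (f : S^o -> M) ->
  klinear ((fun t => f (t * s)) : S^o -> M).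
Proof. by move=> lf c x y; rewrite mulrDl -lf -scalerAl. Qed.

Definition coind_data : actionData.
Proof.
refine (@ActionData hom_fun coind_act hom_fun0 hom_funB _ _ _ _ _ _).
- by [].
- by move=> s t f _; apply: funext => u; rewrite /coind_act mulrA.
- by move=> d f _; apply: funext => u; rewrite /coind_act mulr1.
- by [].
- move=> s t f lf; apply: funext => u.
  by rewrite /coind_act mulrDr; exact: (klinearD lf).
- move=> e d s f hs [lf hf]; split; first exact: klin_mulr.
  by move=> e' t ht; rewrite addrA -PoszD; apply/hf/dhomogM.
Defined.

(** The graded Hom_k(S, M). It is right adjoint to the passage from graded S-modules to graded
    k-spaces, hence injective. *)
Definition coind : gradedModule k n := fun_module coind_data.

(* The cokernel of the embedding m |-> (s |-> s m) of M into coind, where *)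
(* f in coind represents the class of t |-> f t - t f 1. *)
Definition quot_deg (d : int) : set (S -> M) :=
  [set f | hom_fun d f /\ f 1 = 0].

(** The action of [coind], corrected by an S-linear function so that the value at 1 is 0 again. *)
Definition quot_act (s : S) (f : S -> M) : S -> M :=
  fun t => f (t * s) - t *: f s.

Definition quot_data : actionData.
Proof.
refine (@ActionData quot_deg quot_act _ _ _ _ _ _ _ _).
- by move=> d; split; first exact: hom_fun0.
- move=> d f g [hf f1] [hg g1]; split; first exact: hom_funB.
  by change (f 1 - g 1 = 0); rewrite f1 g1 subrr.
- by move=> d f [].
- move=> s t f _; apply: funext => u; rewrite /quot_act mulrA.
  by rewrite scalerBr opprB addrA addrAC scalerA addrAC subrK.
- by move=> d f [_ f1]; apply: funext => u; rewrite /quot_act f1 mulr1 scaler0 subr0.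
- move=> s f g; apply: funext => u; rewrite /quot_act.
  change (f (u * s) + g (u * s) - u *: (f s + g s) =
    f (u * s) - u *: f s + (g (u * s) - u *: g s)).
  by rewrite scalerDr opprD addrACA.
- move=> s t f lf; apply: funext => u; rewrite /quot_act.
  change (f (u * (s + t)) - u *: f (s + t) =
    f (u * s) - u *: f s + (f (u * t) - u *: f t)).
  rewrite mulrDr (klinearD lf) (klinearD lf s t).
  by rewrite scalerDr opprD addrACA.
- move=> e d s f hs [[lf hf] f1]; split; last by rewrite /quot_act mul1r scale1r subrr.
  split=> [c x y|e' t ht].
    rewrite /quot_act (klin_mulr s lf) scalerDl opprD addrACA scalerBr.
    by rewrite [(c%:MP *: x)%R]/GRing.scale /= scalerA.
  apply: gm_degB; first by rewrite addrA -PoszD; apply/hf/dhomogM.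
  by apply: gm_degZ => //; apply: hf.
Defined.

Definition quot : gradedModule k n := fun_module quot_data.

End FunctionModules.

Definition linear_of (R : pzRingType) (U V : lmodType R) (f : U -> V)
    (lf : linear f) : {linear U -> V} :=
  HB.pack f (GRing.isLinear.Build R U V *:%R f lf).

Section Coinduced.
Variables (k : fieldType) (n : nat) (M : gradedModule k n).
Local Notation S := {mpoly k[n]}.

Fact coind_aug_subproof (m : M) :
  (fun s : S => s *: m) \in @fun_pred k n M (coind_data M).
Proof.
apply/asboolP; have [r [_ _ ->]] := gcomp_sum m.
rewrite (_ : (fun _ => _) = \sum_(d <- r) (fun s : S => s *: gcomp d m)).
  apply: homsum_sum => d; apply: (@homsum_hom _ _ d); split.
    by move=> c x y; rewrite scalerDl -scalerA.
  by move=> e s hs; apply: gm_degZ => //; exact: gcompP.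
apply: funext => s; rewrite scaler_sumr fct_sumE; exact: eq_bigr.
Qed.

Definition coind_aug_fun (m : M) : coind M := FunElt (coind_aug_subproof m).

Fact coind_aug_linear : linear coind_aug_fun.
Proof.
move=> s x y; apply/val_inj/funext => t /=.
by rewrite scalerDr scalerA.
Qed.

Definition coind_aug : {linear M -> coind M} := linear_of coind_aug_linear.

Lemma coind_aug_hom : graded_hom coind_aug.
Proof.
move=> d x hx; split=> [c s t|e s hs] /=; last exact: gm_degZ.
by rewrite scalerDl -scalerA.
Qed.

Lemma coind_aug_inj : injective coind_aug.
Proof.
move=> x y /(congr1 val) /= /(congr1 (fun f : S -> M => f 1)).
by rewrite !scale1r.
Qed.

Definition unit_defect (f : S -> M) : S -> M := fun t => f t - t *: f 1.

Lemma unit_defect_deg d f : hom_fun d f -> quot_deg d (unit_defect f).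
Proof.
move=> [lf hf]; split; last by rewrite /unit_defect scale1r subrr.
split=> [c s t|e t ht].
  rewrite /unit_defect lf scalerDl opprD addrACA scalerBr.
  by rewrite [(c%:MP *: s)%R]/GRing.scale /= scalerA.
apply: gm_degB; first exact: hf.
apply: gm_degZ => //; rewrite -[d]add0r; apply: hf; exact: dhomog1.
Qed.

Fact coind_proj_subproof (f : coind M) :
  unit_defect (fun_val f) \in @fun_pred k n M (quot_data M).
Proof.
apply/asboolP; have [l hl ->] := fun_valP f.
rewrite (_ : unit_defect _ = \sum_(g <- l) unit_defect g); last first.
  apply: funext => t; rewrite /unit_defect !fct_sumE scaler_sumr sumrB.
  by [].
rewrite big_seq_cond; elim/big_rec: _ => [|g h /andP[/hl[d hg] _] hh].
  exact: homsum0.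
apply: homsumD => //; apply: (@homsum_hom _ _ d); exact: unit_defect_deg.
Qed.

Definition coind_proj_fun (f : coind M) : quot M := FunElt (coind_proj_subproof f).

Fact coind_proj_linear : linear coind_proj_fun.
Proof.
move=> s f g; apply/val_inj/funext => t.
change (fun_val f (t * s) + fun_val g t - t *: (fun_val f (1 * s) + fun_val g 1) =
  fun_val f (t * s) - (t * s) *: fun_val f 1 - t *: (fun_val f s - s *: fun_val f 1)
  + (fun_val g t - t *: fun_val g 1)).
rewrite mul1r scalerDr scalerBr scalerA opprD opprB.
by rewrite addrACA; congr (_ + _); rewrite addrA subrK.
Qed.

Definition coind_proj : {linear coind M -> quot M} := linear_of coind_proj_linear.

Lemma coind_proj_hom : graded_hom coind_proj.
Proof. by move=> d f hf; exact: unit_defect_deg. Qed.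

Lemma coind_proj_ker f : coind_proj f = 0 <-> exists m, coind_aug m = f.
Proof.
split=> [/(congr1 val) h|[m <-]].
  exists (fun_val f 1); apply/val_inj/funext => t.
  have /eqP := congr1 (fun g : S -> M => g t) h.
  by rewrite [X in X == _]/= /unit_defect subr_eq0 => /eqP /esym.
apply/val_inj/funext => t.
by change (t *: m - t *: (1 *: m) = 0); rewrite scale1r subrr.
Qed.

Lemma coind_proj_surj g : exists f, coind_proj f = g.
Proof.
(* A representative vanishing at 1 is its own preimage. *)
have gP : fun_val g \in @fun_pred k n M (coind_data M).
  apply/asboolP; have [l hl ->] := fun_valP g.
  by exists l => // f /hl[d [hf _]]; exists d.
have g1 : fun_val g 1 = 0.
  have [l hl ->] := fun_valP g.
  by rewrite fct_sumE big_seq_cond big1 // => f /andP[/hl[d [_ ->]]].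
exists (FunElt gP); apply/val_inj/funext => t.
by change (fun_val g t - t *: fun_val g 1 = fun_val g t); rewrite g1 scaler0 subr0.
Qed.

(** By adjunction, f is determined by the k-linear map a |-> (f a) 1. An extension m of that map to
    B gives back the S-linear extension b |-> (s |-> m (s b)). *)
Lemma coind_injective : graded_injective (coind M).
Proof.
move=> A B i f i_hom i_inj f_hom.
have l_lin : klinear (fun a => fun_val (f a) 1).
  move=> c x y; rewrite linearP.
  change (fun_val (f x) (1 * c%:MP) + fun_val (f y) 1 =
    c%:MP *: fun_val (f x) 1 + fun_val (f y) 1).
  congr (_ + _); have lf := fun_val_klinear (f x).
  by have := lf c 1 0; rewrite (klinear0 lf) !addr0 => <-; rewrite mul1r [in RHS]/GRing.scale /= mulr1.
have l_hom d a : gm_deg d a -> gm_deg d (fun_val (f a) 1).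
  move=> /f_hom [_ h]; rewrite -[d]add0r; apply: h; exact: dhomog1.
have [m [m_lin m_hom mE]] := klinear_extension i_inj i_hom l_lin l_hom.
have mh d b : gm_deg d b -> hom_fun d (fun s : S => m (s *: b)).
  move=> hb; split=> [c s t|e s hs]; last exact/m_hom/gm_degZ.
  by rewrite -m_lin scalerA -scalerDl.
have hP b : (fun s : S => m (s *: b)) \in @fun_pred k n M (coind_data M).
  apply/asboolP; have [r [_ _ ->]] := gcomp_sum b.
  rewrite (_ : (fun _ => _) = \sum_(d <- r) (fun s : S => m (s *: gcomp d b))).
    by apply: homsum_sum => d; apply: (@homsum_hom _ _ d); apply/mh/gcompP.
  apply: funext => s; rewrite fct_sumE scaler_sumr (klinear_sum m_lin).
  exact: eq_bigr.
pose h b : coind M := FunElt (hP b).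
have h_lin : linear h.
  move=> s x y; apply/val_inj/funext => t.
  change (m (t *: (s *: x + y)) = m ((t * s) *: x) + m (t *: y)).
  by rewrite scalerDr (klinearD m_lin) scalerA.
exists (linear_of h_lin); split=> [d b hb|a]; first exact: mh.
apply/val_inj/funext => s.
change (m (s *: i a) = fun_val (f a) s).
rewrite -linearZ mE linearZ.
by change (fun_val (f a) (1 * s) = fun_val (f a) s); rewrite mul1r.
Qed.

End Coinduced.

Section Resolution.
Variables (k : fieldType) (n : nat).

Fixpoint iter_quot (M : gradedModule k n) (i : nat) : gradedModule k n :=
  if i is j.+1 then quot (iter_quot M j) else M.

(** Splices the short exact sequences 0 -> N -> [coind] N -> [quot] N -> 0, each N being the
    cokernel of the step before. *)
Lemma exists_injResolution (M : gradedModule k n) : exists E : injResolution M, True.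
Proof.
pose d i : {linear coind (iter_quot M i) -> coind (iter_quot M i.+1)} :=
  (coind_aug (iter_quot M i.+1) \o coind_proj (iter_quot M i)).
have dE i x : d i x = 0 <-> coind_proj (iter_quot M i) x = 0.
  change (coind_aug (iter_quot M i.+1) (coind_proj (iter_quot M i) x) = 0 <->
    coind_proj (iter_quot M i) x = 0).
  split=> [|->]; last by rewrite linear0.
  by rewrite -(linear0 (coind_aug (iter_quot M i.+1))) => /(@coind_aug_inj _ _ _).
unshelve eexists (@InjResolution k n M (fun i => coind (iter_quot M i))
  (coind_aug M) d _ _ _ _ _ _) => //.
- by move=> i; exact: coind_injective.
- exact: coind_aug_hom.
- by move=> i e x hx; apply/coind_aug_hom/coind_proj_hom.
- exact: coind_aug_inj.
- by move=> x; rewrite dE; exact: coind_proj_ker.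
- move=> i x; rewrite dE coind_proj_ker; split=> [[y <-]|[y <-]].
    by have [z <-] := coind_proj_surj y; exists z.
  by exists (coind_proj _ y).
Qed.

End Resolution.

(** * Local cohomology and filter-regular sequences *)

Section Ideals.
Variables (k : fieldType) (n : nat).
Local Notation S := {mpoly k[n]}.

Lemma ideal0 (I : set S) : is_ideal I -> I 0.
Proof. by case. Qed.

Lemma idealD (I : set S) f g : is_ideal I -> I f -> I g -> I (f + g).
Proof. by move=> [_ h _]; exact: h. Qed.

Lemma idealM (I : set S) f g : is_ideal I -> I g -> I (f * g).
Proof. by move=> [_ _ h]; exact: h. Qed.

Lemma idealN (I : set S) f : is_ideal I -> I f -> I (- f).
Proof. by move=> hI If; rewrite -mulN1r; exact: idealM. Qed.

Lemma idealB (I : set S) f g : is_ideal I -> I f -> I g -> I (f - g).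
Proof. by move=> hI If Ig; apply: idealD => //; exact: idealN. Qed.

Lemma idealZ (I : set S) (c : k) f : is_ideal I -> I f -> I (c *: f).
Proof. by move=> hI If; rewrite -mul_mpolyC; exact: idealM. Qed.

Lemma ideal_sum_closed (I : set S) (T : eqType) (r : seq T) (F : T -> S) :
  is_ideal I -> (forall i, i \in r -> I (F i)) -> I (\sum_(i <- r) F i).
Proof.
move=> hI hF; rewrite big_seq; elim/big_rec: _ => [|i x ir Ix]; first exact: ideal0.
by apply: idealD => //; exact: hF.
Qed.

Lemma hideal0 (I : homogIdeal k n) : hideal_set I 0.
Proof. by apply: ideal0; exact: hideal_ideal. Qed.

Lemma pihomog_sum (f : S) : f = \sum_(d < mmeasure mdeg f) pihomog mdeg d f.
Proof. exact: pihomog_partitionE. Qed.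

Lemma pihomogMl (e d : nat) (z s : S) : z \is e.-homog ->
  pihomog mdeg d (z * s) = if (e <= d)%N then z * pihomog mdeg (d - e) s else 0.
Proof.
move=> hz; rewrite {1}(pihomog_sum s) mulr_sumr raddf_sum /=.
have hi (i : nat) : z * pihomog mdeg i s \is (e + i)%N.-homog.
  by apply: dhomogM => //; exact: pihomogP.
have hcomp (i : nat) : pihomog mdeg d (z * pihomog mdeg i s) =
    if (e + i)%N == d then z * pihomog mdeg i s else 0.
  case: eqP => [<-|/eqP ne]; first exact: pihomog_dE.
  exact: pihomog_ne0 (hi i).
under eq_bigr do rewrite hcomp.
case: leqP => [le_ed|lt_de]; last first.
  by rewrite big1 // => i _; case: eqP => // E; move: lt_de; rewrite -E ltnNge leq_addr.
have -> : z * pihomog mdeg (d - e) s =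
    \sum_(i < mmeasure mdeg s) z * pihomog mdeg (d - e) (pihomog mdeg i s).
  by rewrite -mulr_sumr -linear_sum -pihomog_sum.
apply: eq_bigr => i _; case: eqP => E.
  by rewrite -E addKn (pihomog_dE (pihomogP _ _ _)).
rewrite (pihomog_ne0 _ (pihomogP _ _ _)) ?mulr0 //.
by apply/eqP => iE; apply: E; rewrite iE subnKC.
Qed.

Fact setT_ideal : is_ideal (setT : set S).
Proof. by []. Qed.

Definition unit_ideal : homogIdeal k n :=
  HomogIdeal setT_ideal (fun _ _ _ => I).

Definition add_elt_set (a : set S) (z : S) : set S :=
  [set f | exists s, a (f - z * s)].

Fact add_elt_ideal (a : set S) z : is_ideal a -> is_ideal (add_elt_set a z).
Proof.
move=> ha; split=> [|f g [s hs] [t ht]|f g [s hs]].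
- by exists 0; rewrite mulr0 subr0; exact: ideal0.
- by exists (s + t); rewrite mulrDr opprD addrACA; exact: idealD.
- by exists (f * s); rewrite mulrCA -mulrBr; exact: idealM.
Qed.

Fact add_elt_homog (a : homogIdeal k n) e z (d : nat) f : z \is e.-homog ->
  add_elt_set a z f -> add_elt_set a z (pihomog mdeg d f).
Proof.
move=> hz [s /(hideal_homog d)]; rewrite pihomogB (pihomogMl _ _ hz).
case: leqP => _ h; first by exists (pihomog mdeg (d - e) s).
by exists 0; rewrite mulr0.
Qed.

Definition add_elt (a : homogIdeal k n) e z (hz : z \is e.-homog) : homogIdeal k n :=
  HomogIdeal (add_elt_ideal z (hideal_ideal a))
    (fun d f => @add_elt_homog a e z d f hz).

(** Taking parts of degree d makes the cofactor of z homogeneous. The first alternative covers d <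
    e, where the cofactor would have negative degree. *)
Lemma add_elt_homog_witness (a : homogIdeal k n) e z d f :
  z \is e.-homog -> f \is d.-homog -> add_elt_set a z f ->
  hideal_set a f \/
  exists2 s, (e <= d)%N /\ s \is (d - e)%N.-homog & hideal_set a (f - z * s).
Proof.
move=> hz hf [s /(hideal_homog d)].
rewrite pihomogB (pihomog_dE hf) (pihomogMl _ _ hz); case: leqP => _; last first.
  by rewrite subr0; left.
by move=> h; right; exists (pihomog mdeg (d - e) s) => //; split=> //; exact: pihomogP.
Qed.

Section Division.
Variable M : gradedModule k n.

(** [graded_injective] speaks of degree-preserving maps only; the shift turns the map z |-> x of
    degree d in [injective_divides] into one. *)
Definition shift_module (d : int) : gradedModule k n.
Proof.
refine (@GradedModule k n (gm_mod M) (fun e => @gm_deg k n M (e - d)) _ _ _ _ _).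
- by move=> e; exact: gm_deg0.
- by move=> e; exact: gm_degB.
- by move=> e e' f x hf hx; rewrite -addrA; exact: gm_degZ.
- move=> x; have [r [_ _ xE]] := gcomp_sum x.
  exists [seq e + d | e <- r], (fun e => gcomp (e - d) x); split.
    by move=> e; exact: gcompP.
  by rewrite big_map {1}xE; apply: eq_bigr => e _; rewrite addrK.
- move=> r c ur hc c0 e er.
  have h e' : gm_deg e' (c (e' + d)) by have := hc (e' + d); rewrite addrK.
  have u : uniq [seq e' - d | e' <- r] by rewrite map_inj_uniq //; exact: addIr.
  have := gm_direct u h; move=> /(_ _ (e - d)); rewrite subrK.
  apply; last exact: map_f.
  by rewrite big_map -[RHS]c0; apply: eq_bigr => e' _; rewrite subrK.
Defined.

End Division.

(* y is the image of 1 under an extension to S of the map a + (z) -> E that *)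
(* kills a and sends z to x. *)
Lemma injective_divides (E : gradedModule k n) (a : homogIdeal k n) e d z (x : E) :
  graded_injective E -> z \is e.-homog -> gm_deg (e%:Z + d) x ->
  (forall s, hideal_set a (z * s) -> s *: x = 0) ->
  exists y, [/\ gm_deg d y, z *: y = x & forall s, hideal_set a s -> s *: y = 0].
Proof.
move=> Einj hz hx ann.
have ha := hideal_ideal a.
pose b := add_elt a hz.
have quo_ex (f : ideal_elt b) : exists s, hideal_set a ((ideal_val f : S) - z * s).
  by case: f => f fb; apply: asboolW fb.
have /choice[quo quoP] := quo_ex.
(* Cofactors are unique up to elements s with z s in a, and these kill x; so f |-> [quo f *: x] does
   not depend on the choice. *)
have quoE (f : ideal_elt b) s : hideal_set a ((ideal_val f : S) - z * s) -> quo f *: x = s *: x.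
  move=> hs; apply/eqP; rewrite -subr_eq0 -scalerBl; apply/eqP/ann.
  by have := idealB ha hs (quoP f); rewrite opprB addrC addrA subrK mulrBr.
have f_lin : linear (fun f : ideal_elt b => quo f *: x).
  move=> s f g; rewrite (quoE _ (s * quo f + quo g)) ?scalerDl ?scalerA //.
  rewrite [ideal_val _](_ : _ = s * (ideal_val f : S) + ideal_val g) //.
  rewrite mulrDr mulrCA opprD addrACA -mulrBr; apply: idealD => //.
  exact: idealM.
pose A := shift_module (ideal_module b) d.
pose B := shift_module (ideal_module unit_ideal) d.
have i_mem (f : ideal_elt b) : (ideal_val f : S^o) \in hideal_pred unit_ideal.
  exact/asboolP.
pose i (f : A) : B := IdealElt (i_mem f).
have i_lin : linear i by move=> s f g; apply/val_inj.
have i_hom : graded_hom (linear_of i_lin : {linear A -> B}).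
  move=> e' [f fb]; rewrite /= /ideal_deg /=; case: (e' - d) => // e'' h.
  by apply: val_inj; have := congr1 val h.
have i_inj : injective (linear_of i_lin : {linear A -> B}).
  by move=> f g /(congr1 val) /= h; apply: val_inj.
have f_hom : graded_hom (linear_of (f_lin : linear (_ : A -> E))).
  move=> e' f; rewrite /= /ideal_deg /=; case E' : (e' - d) => [m|m]; last first.
    by move=> ->; rewrite (quoE 0 0) ?scale0r ?mulr0 ?subr0;
      [exact: gm_deg0|exact: ideal0].
  move=> hf; case: f hf => f /= fb hf.
  have [af|[s [le_em hs] as_]] := add_elt_homog_witness hz hf (asboolW fb).
    by rewrite (quoE _ 0) ?mulr0 ?subr0 // scale0r; exact: gm_deg0.
  rewrite (quoE _ s) //.
  have -> : e' = (m - e)%N%:Z + (e%:Z + d) by rewrite addrA -PoszD subnK // -E' subrK.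
  exact: gm_degZ.
have [h [h_hom hE]] := Einj A B _ _ i_hom i_inj f_hom.
have one_mem : (1 : S^o) \in hideal_pred unit_ideal by exact/asboolP.
have in_b f : add_elt_set (hideal_set a) z f -> (f : S^o) \in hideal_pred b.
  by move=> h'; exact/asboolP.
have h1 f (fb : (f : S^o) \in hideal_pred b) : f *: h (IdealElt one_mem : B) = quo (IdealElt fb) *: x.
  rewrite -linearZ; transitivity (h (linear_of i_lin (IdealElt fb))); last exact: hE.
  congr (h _); apply/val_inj => /=.
  by rewrite [LHS]/GRing.scale /= mulr1.
exists (h (IdealElt one_mem : B)); split.
- apply: h_hom; rewrite /= subrr /=; exact: dhomog1.
- have zb : add_elt_set (hideal_set a) z z.
    by exists 1; rewrite mulr1 subrr; exact: ideal0.
  rewrite (h1 _ (in_b _ zb)) (quoE _ 1) ?scale1r //= mulr1 subrr; exact: ideal0.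
- move=> s as_; have sb : add_elt_set (hideal_set a) z s.
    by exists 0; rewrite mulr0 subr0.
  by rewrite (h1 _ (in_b _ sb)) (quoE _ 0) ?scale0r //= mulr0 subr0.
Qed.

End Ideals.

Section Torsion.
Variables (k : fieldType) (n : nat).
Local Notation S := {mpoly k[n]}.

Lemma exists_submonomial (m : 'X_{1..n}) r : (r <= mdeg m)%N ->
  exists2 m' : 'X_{1..n}, (m' <= m)%MM & mdeg m' = r.
Proof.
move=> /subnKC; move: (mdeg m - r)%N => d; elim: d m => [|d IH] m.
  by rewrite addn0 => ->; exists m => //; exact: lepm_refl.
rewrite addnS => E.
have [i mi] : exists i, m i != 0%N.
  apply: contrapT => h; suff m0 : m = 0%MM by move: E; rewrite m0 mdeg0.
  apply/mnmP => i; rewrite mnm0E; apply: contrapT => hi; apply: h.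
  by exists i; apply/eqP.
have le_im : (U_(i) <= m)%MM by rewrite lep1mP.
have [|m' le_m' <-] := IH (m - U_(i))%MM.
  have := congr1 (@mdeg n) (submK le_im).
  by rewrite mdegD mdeg1 addn1 -E => -[->].
by exists m' => //; apply: lepm_trans le_m' (lem_subr _ _).
Qed.

Lemma ideal_gen_ideal (A : set S) : is_ideal (ideal_gen A).
Proof.
split=> [I hI _|f g hf hg I hI AI|f g hg I hI AI]; first exact: ideal0.
- by apply: idealD => //; [exact: hf|exact: hg].
- by apply: idealM => //; exact: hg.
Qed.

Lemma ideal_genS (A : set S) f : A f -> ideal_gen A f.
Proof. by move=> Af I _; apply. Qed.

Lemma max_ideal_pow_homog r e (f : S) : (r <= e)%N -> f \is e.-homog ->
  max_ideal_pow r f.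
Proof.
move=> le_re /dhomogP hf; have hI := ideal_gen_ideal
  [set ('X_[m] : S) | m in [set m : 'X_{1..n} | mdeg m = r]].
rewrite [f]mpolyE; apply: (ideal_sum_closed hI) => m /hf mE.
apply: (idealZ _ hI).
have [|m' le_m' m'r] := @exists_submonomial m r; first by rewrite mE.
rewrite -(submK le_m') mpolyXD; apply: (idealM _ hI).
by apply: ideal_genS; exists m'.
Qed.

Lemma torsionP (M : gradedModule k n) (x : M) : torsion x <->
  exists r, forall e (f : S), (r <= e)%N -> f \is e.-homog -> f *: x = 0.
Proof.
split=> [[r hr]|[r hr]]; exists r.
  by move=> e f le_re hf; apply: hr; exact: max_ideal_pow_homog hf.
move=> f hf; apply: (hf [set f | f *: x = 0]) => [|_ [m /= mr <-]].
  split=> /= [|g h hg hh|g h hh]; first by rewrite scale0r.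
  - by rewrite scalerDl hg hh addr0.
  - by rewrite -scalerA hh scaler0.
by apply: (hr r) => //; rewrite dhomogX; apply/eqP.
Qed.

Lemma torsion0 (M : gradedModule k n) : torsion (0 : M).
Proof. by exists 0%N => f _; rewrite scaler0. Qed.

Lemma torsionB (M : gradedModule k n) (x y : M) :
  torsion x -> torsion y -> torsion (x - y).
Proof.
move=> /torsionP[r hr] /torsionP[s hs]; apply/torsionP; exists (maxn r s) => e f.
by rewrite geq_max => /andP[re se] hf; rewrite scalerBr (hr e) // (hs e) // subrr.
Qed.

Lemma torsionZ (M : gradedModule k n) (f : S) (x : M) : torsion x -> torsion (f *: x).
Proof.
by move=> [r hr]; exists r => g hg; rewrite scalerA mulrC -scalerA hr // scaler0.
Qed.

Lemma torsion_linear (M N : gradedModule k n) (f : {linear M -> N}) x :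
  torsion x -> torsion (f x).
Proof. by move=> [r hr]; exists r => g hg; rewrite -linearZ hr // linear0. Qed.

Lemma torsion_gcomp (M : gradedModule k n) d (x : M) : torsion x -> torsion (gcomp d x).
Proof.
move=> /torsionP[r hr]; apply/torsionP; exists r => e f le_re hf.
by rewrite -(gcompZ _ _ hf) (hr e) // gcomp0.
Qed.

Lemma torsion_exp (M : gradedModule k n) (z : S) (x : M) :
  z \is 1.-homog -> torsion x -> exists N, z ^+ N *: x = 0.
Proof.
move=> hz /torsionP[r hr]; exists r; apply: (hr r) => //.
by have := dhomogMn r hz; rewrite mul1n.
Qed.

End Torsion.

(** * Ext and local cohomology through subcomplexes of a resolution *)

Section Complex.
Variables (k : fieldType) (n : nat) (M : gradedModule k n) (E : injResolution M).
Local Notation S := {mpoly k[n]}.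
Local Notation family := (forall i, set (res_obj E i)).
Local Notation diff := (res_diff E).

Definition stable (A : family) : Prop :=
  [/\ forall i, A i 0, forall i x y, A i x -> A i y -> A i (x - y),
      forall i x, A i x -> A i.+1 (diff i x)
    & forall i (f : S) x, A i x -> A i (f *: x)].

Definition bd (A : family) i (d : int) : set (res_obj E i) :=
  match i return set (res_obj E i) with
  | 0 => [set 0]
  | j.+1 => [set x | exists y, [/\ A j y, gm_deg d y & diff j y = x]]
  end.

(** H^i(A)_d = 0 for the subcomplex A of the resolution. *)
Definition van (A : family) i (d : int) : Prop :=
  forall x, A i x -> gm_deg d x -> diff i x = 0 -> bd A d x.

(** Injectivity of z : H^i(A)_d -> H^i(A)_(d+1). *)
Definition mul_inj (A : family) (z : S) i (d : int) : Prop :=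
  forall x, A i x -> gm_deg d x -> diff i x = 0 ->
    bd A (1%:Z + d) (z *: x) -> bd A d x.

Definition ann_family (A : family) (z : S) : family :=
  fun i => [set x | A i x /\ z *: x = 0].

Arguments ann_family : clear implicits.

(** Exactness of 0 -> (0 :_A z) -> A -> A(1) -> 0 on the right; its long exact sequence is used
    piecewise in the lemmas on [van] and [mul_inj]. *)
Definition divisible (A : family) (z : S) : Prop :=
  forall i d x, A i x -> gm_deg (1%:Z + d) x ->
    exists y, [/\ A i y, gm_deg d y & z *: y = x].

Lemma diff_diff i x : diff i.+1 (diff i x) = 0.
Proof. by apply/res_exactS; exists x. Qed.

Lemma stableD A i x y : stable A -> A i x -> A i y -> A i (x + y).
Proof.
move=> [A0 AB _ _] Ax Ay; rewrite -[y]opprK; apply: (AB) => //.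
by rewrite -sub0r; apply: AB.
Qed.

Lemma bd0 A i d : stable A -> bd A d (0 : res_obj E i).
Proof.
by move=> [A0 _ _ _]; case: i => [//|i]; exists 0; split; rewrite ?linear0 //; exact: gm_deg0.
Qed.

Lemma ann_family_stable A z : stable A -> stable (ann_family A z).
Proof.
move=> [A0 AB AD AZ]; split.
- by move=> i; split; rewrite ?scaler0.
- by move=> i x y [Ax zx] [Ay zy]; split; [exact: AB|rewrite scalerBr zx zy subr0].
- by move=> i x [Ax zx]; split; [exact: AD|rewrite -linearZ zx linear0].
- by move=> i f x [Ax zx]; split; [exact: AZ|rewrite scalerA mulrC -scalerA zx scaler0].
Qed.

Section Step.
Variables (A : family) (z : S).
Arguments A : clear implicits.
Hypotheses (hA : stable A) (hz : z \is 1.-homog) (hdiv : divisible A z).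

(** If z y is the coboundary of w = z w', subtracting the coboundary of w' from y makes it killed by
    z and leaves its differential unchanged. *)
Lemma bd_mul_lift i d y : A i y -> gm_deg d y -> bd A (1%:Z + d) (z *: y) ->
  exists u, [/\ ann_family A z i u, gm_deg d u & diff i u = diff i y].
Proof.
have [A0 AB AD AZ] := hA.
case: i y => [|i] y Ay hy /=; first by move=> zy; exists y; split.
move=> [w [Aw hw wE]]; have [w' [Aw' hw' w'E]] := hdiv Aw hw.
exists (y - diff i w'); split.
- split; first by apply: AB => //; exact: AD.
  by rewrite scalerBr -linearZ w'E wE subrr.
- by apply: gm_degB => //; exact: res_diff_hom.
- by rewrite linearB diff_diff subr0.
Qed.

(** Exactness of H^i(0 :_A z)_d -> H^i(A)_d -> H^i(A)_(d+1). *)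
Lemma van_ann_mul_inj i d : van (ann_family A z) i d -> mul_inj A z i d.
Proof.
have [A0 AB AD AZ] := hA.
case: i => [|i] hv x Ax hx dx; first by move=> /= zx; apply: hv.
move=> [w [Aw hw wE]]; have [w' [Aw' hw' w'E]] := hdiv Aw hw.
have [||u [[Au _] hu uE]] := hv (x - diff i w') _ (gm_degB hx (res_diff_hom hw')).
- split; first by apply: AB => //; exact: AD.
  by rewrite scalerBr -linearZ w'E wE subrr.
- by rewrite linearB dx diff_diff subrr.
exists (u + w'); split; [exact: stableD|exact: gm_degD|].
by rewrite linearD uE subrK.
Qed.

(** Exactness of H^(i-1)(A)_(d+1) -> H^i(0 :_A z)_d -> H^i(A)_d; for i = 0 the first term is
    absent. *)
Lemma van_ann i d : (forall j, i = j.+1 -> van A j (1%:Z + d)) ->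
  mul_inj A z i d -> van (ann_family A z) i d.
Proof.
have [A0 AB AD AZ] := hA.
move=> hv hi x [Ax zx] hx dx.
have : bd A d x by apply: hi => //; rewrite zx; exact: bd0.
case: i hv hi x Ax zx hx dx => [//|i] hv _ x Ax zx hx dx [y [Ay hy yE]].
have /(hv i erefl) : A i (z *: y) by exact: AZ.
have hzy : gm_deg (1%:Z + d) (z *: y) by exact: gm_degZ.
have dzy : diff i (z *: y) = 0 by rewrite linearZ yE.
by move=> /(_ hzy dzy)/(bd_mul_lift Ay hy)[u [Au hu uE]]; exists u; rewrite uE.
Qed.

Lemma mul_inj_exp i (d0 : int) N x : (forall d, d0 <= d -> mul_inj A z i d) ->
  A i x -> gm_deg d0 x -> diff i x = 0 ->
  bd A (N%:Z + d0) (z ^+ N *: x) -> bd A d0 x.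
Proof.
have [A0 AB AD AZ] := hA.
elim: N d0 x => [|N IH] d0 x hi Ax hx dx; first by rewrite expr0 scale1r add0r.
rewrite exprSr -scalerA => h; apply: (hi) => //.
apply: (IH _ (z *: x)) => //.
- by move=> d led; apply: hi; apply: le_trans led; rewrite lerDr.
- exact: AZ.
- exact: gm_degZ.
- by rewrite linearZ dx /= scaler0.
- by rewrite addrA -PoszD addn1.
Qed.

End Step.

Variable z : nat -> S.
Hypothesis hz : forall j, z j \is 1.-homog.

Fixpoint ann_chain (T : family) (j : nat) : family :=
  if j is l.+1 then ann_family (ann_chain T l) (z l) else T.

Arguments ann_chain : clear implicits.

Lemma ann_chainP (T : family) j i x :
  ann_chain T j i x <-> T _ x /\ forall l, (l < j)%N -> z l *: x = 0.
Proof.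
elim: j => [|j IH] /=; first by split=> [//|[]].
split=> [[/IH[Tx h] zx]|[Tx h]].
  split=> // l; rewrite ltnS leq_eqVlt => /orP[/eqP ->//|]; exact: h.
by split; [apply/IH; split=> // l lj; apply: h; exact: ltnW|exact: h].
Qed.

Lemma ann_chain_stable T j : stable T -> stable (ann_chain T j).
Proof. by move=> hT; elim: j => //= j; exact: ann_family_stable. Qed.

Let full : family := fun _ => setT.
Let tors : family := fun i => @torsion k n (res_obj E i).
Arguments full : clear implicits.
Arguments tors : clear implicits.

Lemma full_stable : stable full.
Proof. by []. Qed.

Lemma tors_stable : stable tors.
Proof.
split=> [i|i x y|i x|i f x]; first exact: torsion0.
- exact: torsionB.
- exact: torsion_linear.
- exact: torsionZ.
Qed.

Lemma tors_vanP i d :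
  van tors i d <-> (@lc_cocycle k n M E i d `<=` @lc_coboundary k n M E i).
Proof.
split=> [hv x [Tx hx dx]|h x Tx hx dx].
  have := hv x Tx hx dx; case: i hv x Tx hx dx => [//|i] hv x Tx hx dx.
  by move=> [y [Ty _ <-]]; exists y.
have := h x; move=> /(_ (And3 Tx hx dx)).
case: i h x Tx hx dx => [//|i] h x Tx hx dx [y Ty yE].
exists (gcomp d y); split; [exact: torsion_gcomp|exact: gcompP|].
rewrite -gcomp_graded_hom; last exact: res_diff_hom.
by rewrite yE gcomp_id.
Qed.

Hypothesis full_div : forall j, (j < n)%N -> divisible (ann_chain full j) (z j).
Hypothesis tors_div : forall j, (j < n)%N -> divisible (ann_chain tors j) (z j).
Hypothesis ann_tors : forall i (x : res_obj E i),
  (forall l, (l < n)%N -> z l *: x = 0) -> torsion x.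

Section Bounds.
Variables (c : nat -> int) (t : nat).
Hypothesis hc : forall i, c i <= c i.+1 + 1.

Definition van_beyond (A : family) : Prop :=
  forall i, (i <= t)%N -> forall d : int, c i < d -> van A i d.

(** The form required by the connecting map, which goes from H^i in degree d + 1 to H^(i+1) in
    degree d. *)
Lemma bound_pred i d : c i.+1 < d -> c i < 1%:Z + d.
Proof. by move=> h; apply: le_lt_trans (hc i) _; rewrite addrC ltrD2l. Qed.

Lemma tors_van_beyond j : (j <= n)%N ->
  van_beyond tors <-> van_beyond (ann_chain tors j).
Proof.
elim: j => [//|j IH] jn; rewrite IH; last exact: ltnW.
have hA := ann_chain_stable j tors_stable; have hd := tors_div jn.
split=> hv i it d cd.
  apply: (van_ann hA (hz j) hd) => [i' iE|x Ax hx dx _]; last exact: hv.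
  by apply: hv; [rewrite iE in it; exact: ltnW|apply: bound_pred; rewrite -iE].
(* A power of z_j kills the torsion element x, and z_j is injective on cohomology in all degrees
   from d on; hence x is a coboundary. *)
move=> x Ax hx dx; have /ann_chainP[Tx _] := Ax.
have [N zN] := torsion_exp (hz j) Tx.
apply: (@mul_inj_exp _ _ hA (hz j) i d N x) => //; last by rewrite zN; exact: bd0.
move=> d' dd'; apply: (van_ann_mul_inj hA hd); apply: hv => //.
exact: lt_le_trans cd dd'.
Qed.

Lemma tors_full_chain i x : ann_chain tors n i x <-> ann_chain full n i x.
Proof.
rewrite !ann_chainP; split=> [[_ h]//|[_ h]]; split=> //; exact: ann_tors.
Qed.

(** Elements killed by all z_l are torsion, so both chains of annihilators end in the same complex,
    which computes Ext^i(k, M) when the z_l span the linear forms. *)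
Lemma tors_van_full : van_beyond tors <-> van_beyond (ann_chain full n).
Proof.
rewrite (tors_van_beyond (leqnn n)).
suff -> : ann_chain tors n = ann_chain full n by [].
by apply: functional_extensionality_dep => i; apply/seteqP; split=> x /tors_full_chain.
Qed.

(** The cohomology of [ann_chain full j] is Ext^i(S/(z_0, .., z_(j-1)), M). In passing from j to j +
    1 only the index i = j is new, and there the assumption on z_j applies. *)
Lemma full_van_lt :
  (forall j, (j < n)%N -> (j <= t)%N -> forall d : int, c j < d ->
    mul_inj (ann_chain full j) (z j) j d) ->
  forall j, (j <= n)%N -> forall i, (i < j)%N -> (i <= t)%N -> forall d : int, c i < d ->
    van (ann_chain full j) i d.
Proof.
move=> hi; elim=> [//|j IH] jn i; rewrite ltnS => ij it d cd.
have hA := ann_chain_stable j full_stable; have hd := full_div jn.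
apply: (van_ann hA (hz j) hd) => [i' iE|].
  rewrite iE in ij it cd; apply: IH => //; [exact: ltnW|exact: ltnW|].
  exact: bound_pred.
move: ij; rewrite leq_eqVlt => /orP[/eqP iE|ij].
  by rewrite iE in it cd *; exact: hi.
by move=> x Ax hx dx _; apply: IH => //; exact: ltnW.
Qed.

End Bounds.

(** S/(z_0, .., z_(j-1)) has projective dimension at most j. The induction starts from exactness of
    the resolution in positive positions. *)
Lemma full_van_gt j i d : (j <= n)%N -> (j < i)%N -> van (ann_chain full j) i d.
Proof.
elim: j i d => [|j IH] i d jn ji.
  case: i ji => [//|i] _ x _ hx /res_exactS[y yE].
  exists (gcomp d y); split=> //; first exact: gcompP.
  by rewrite -gcomp_graded_hom ?yE ?gcomp_id //; exact: res_diff_hom.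
have hA := ann_chain_stable j full_stable; have hd := full_div jn.
apply: (van_ann hA (hz j) hd) => [i' iE|x Ax hx dx _].
  by apply: IH; [exact: ltnW|rewrite iE in ji].
by apply: IH => //; exact: ltnW.
Qed.

(** The bound D is filter-regularity. It replaces torsion in the descent from n to j: a power of z_j
    need not kill a class, but carries it to degrees where the cohomology below index j vanishes.
    The index i = n is never below some j <= n, hence the separate clause for t = n. *)
Lemma full_van_beyond (c : nat -> int) t : (forall i, c i <= c i.+1 + 1) ->
  (t <= n)%N ->
  (exists D : int, forall j, (j < n)%N -> forall d : int, D < d ->
    mul_inj (ann_chain full j) (z j) j d) ->
  van_beyond c t (ann_chain full n) <->
  (forall j, (j < n)%N -> (j <= t)%N -> forall d : int, c j < d ->
    mul_inj (ann_chain full j) (z j) j d) /\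
  (t = n -> forall d : int, c n < d -> van (ann_chain full n) n d).
Proof.
move=> hc tn [D hD]; split=> [hv|[hi hn] i it d cd]; last first.
  have := it; rewrite leq_eqVlt => /orP[/eqP iE|lt_it].
    have := tn; rewrite leq_eqVlt => /orP[/eqP tE|lt_tn].
      by rewrite iE tE in cd *; exact: hn.
    by apply: (full_van_lt hc hi) => //; rewrite iE.
  by apply: (full_van_lt hc hi) => //; exact: leq_trans lt_it tn.
have hbig j i (d : int) : (j <= n)%N -> (i < j)%N -> D < d -> van (ann_chain full j) i d.
  move=> jn ij dD; apply: (@full_van_lt (fun _ => D) n) => //.
  - by move=> _; rewrite lerDl.
  - by move=> j' j'n _ d' Dd'; exact: hD.
  - by apply: ltnW; exact: leq_trans ij jn.
have down j : (j <= n)%N -> forall i, (i < j)%N -> (i <= t)%N -> forall d : int, c i < d ->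
    van (ann_chain full j) i d.
  move=> /subnKC; move: (n - j)%N => m; elim: m j => [|m IH] j.
    by rewrite addn0 => -> i _ it d cd; exact: hv.
  rewrite addnS -addSn => jm i ij it d cd x Ax hx dx.
  have jn : (j < n)%N by rewrite -jm leq_addr.
  have hA := ann_chain_stable j full_stable; have hd := full_div jn.
  have [A0 _ _ AZ] := hA.
  (* This makes N + d > D, the range in which [hbig] applies to z_j^N x. *)
  pose N := absz (D + 1 - d)%R.
  apply: (@mul_inj_exp _ _ hA (hz j) i d N x) => //.
    move=> d' dd'; apply: (van_ann_mul_inj hA hd); apply: (IH _ jm) => //.
      exact: ltnW.
    exact: lt_le_trans cd dd'.
  apply: (hbig j) => //; [exact: ltnW|rewrite /N; lia|exact: AZ| |].
    by apply: gm_degZ => //; have := dhomogMn N (hz j); rewrite mul1n.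
  by rewrite linearZ dx /= scaler0.
split=> [j jn jt d cd|tE d cd]; last by apply: hv => //; rewrite tE.
have hA := ann_chain_stable j full_stable; have hd := full_div jn.
by apply: (van_ann_mul_inj hA hd); exact: (down j.+1).
Qed.

(* m in (z_0, .., z_(j-1)) M, for m of degree e. *)
Fixpoint in_zM (j : nat) (e : int) (m : M) : Prop :=
  if j is l.+1 then exists2 m', gm_deg (e - 1) m' & in_zM l e (m - z l *: m')
  else m = 0.

(* The connecting isomorphisms M / (z_0, .., z_(j-1)) M -> Ext^j(S / (z_0, .., *)
(* z_(j-1)), M) as a relation between representatives. *)
Fixpoint connected (j : nat) : int -> M -> set (res_obj E j) :=
  match j return int -> M -> set (res_obj E j) with
  | 0 => fun d m x => gm_deg d m /\ res_aug E m = x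
  | l.+1 => fun d m x => exists w : res_obj E l,
      [/\ ann_chain full l l w, gm_deg d w,
          connected (1%:Z + d) m (z l *: w) & diff l w = x]
  end.

Lemma connected_cocycle j d m x : connected d m x ->
  [/\ ann_chain full j j x, gm_deg d x, diff j x = 0 & gm_deg (j%:Z + d) m].
Proof.
elim: j d m x => [|j IH] d m x.
  move=> [hm <-]; split=> //; first exact: res_aug_hom.
    by apply/res_exact0; exists m.
  by rewrite add0r.
move=> [w [Ww hw /IH[Wz hzw dzw hm] <-]]; split.
- split; last by rewrite -linearZ.
  by have [_ _ AD _] := ann_chain_stable j full_stable; exact: AD.
- exact: res_diff_hom.
- exact: diff_diff.
- by move: hm; rewrite addrA -PoszD addn1.
Qed.

Lemma connectedB j d m m' (x x' : res_obj E j) :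
  connected d m x -> connected d m' x' -> connected d (m - m') (x - x').
Proof.
elim: j d m m' x x' => [|j IH] d m m' x x'.
  by move=> [hm <-] [hm' <-]; split; [exact: gm_degB|rewrite linearB].
move=> [w [Ww hw cw <-]] [w' [Ww' hw' cw' <-]]; exists (w - w'); split.
- by have [_ AB _ _] := ann_chain_stable j full_stable; exact: AB.
- exact: gm_degB.
- by rewrite scalerBr; exact: IH.
- by rewrite linearB.
Qed.

Lemma connectedZ j d m (x : res_obj E j) (s : S) : s \is 1.-homog ->
  connected d m x -> connected (1%:Z + d) (s *: m) (s *: x).
Proof.
move=> hs; elim: j d m x => [|j IH] d m x.
  by move=> [hm <-]; split; [exact: gm_degZ|rewrite linearZ].
move=> [w [Ww hw /IH cw <-]]; exists (s *: w); split.
- by have [_ _ _ AZ] := ann_chain_stable j full_stable; exact: AZ.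
- exact: gm_degZ.
- by rewrite scalerA mulrC -scalerA.
- by rewrite linearZ.
Qed.

Lemma connected_total j d m : (j <= n)%N -> gm_deg (j%:Z + d) m ->
  exists x : res_obj E j, connected d m x.
Proof.
elim: j d => [|j IH] d jn hm.
  by exists (res_aug E m); split=> //; move: hm; rewrite add0r.
have [||y cy] := IH (1%:Z + d); [exact: ltnW|by rewrite addrA -PoszD addn1|].
have [Wy hy dy _] := connected_cocycle cy.
have [w [Ww hw wE]] := full_div jn Wy hy.
by exists (diff j w); exists w; split=> //; rewrite wE.
Qed.

(** The complex of chain j is acyclic in position j + 1, so x is the differential of some w there;
    z_j w is a cocycle because z_j x = 0, and induction applies to it. *)
Lemma connected_surj j d (x : res_obj E j) : (j <= n)%N ->
  ann_chain full j j x -> gm_deg d x -> diff j x = 0 -> exists m, connected d m x.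
Proof.
elim: j d x => [|j IH] d x jn Wx hx dx.
  have /res_exact0[m mE] := dx; exists (gcomp d m); split; first exact: gcompP.
  by rewrite -gcomp_graded_hom ?mE ?gcomp_id //; exact: res_aug_hom.
have [Wx' zx] := Wx.
have [w [Ww hw wE]] : bd (ann_chain full j) d x.
  by apply: full_van_gt => //; exact: ltnW.
have [||||m cm] := IH (1%:Z + d) (z j *: w).
- exact: ltnW.
- by have [_ _ _ AZ] := ann_chain_stable j full_stable; exact: AZ.
- exact: gm_degZ.
- by rewrite linearZ wE.
by exists m, w; split.
Qed.

(** With totality and surjectivity, this makes [connected] an isomorphism from the degree j + d part
    of M/(z_0, .., z_(j-1))M onto H^j of chain j in degree d. *)
Lemma connected_bd j d m (x : res_obj E j) : (j <= n)%N -> connected d m x ->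
  bd (ann_chain full j) d x <-> in_zM j (j%:Z + d) m.
Proof.
elim: j d m x => [|j IH] d m x jn.
  move=> [hm <-] /=; split=> [|->]; last exact: linear0.
  by rewrite -(linear0 (res_aug E)) => /(@res_aug_inj _ _ _ E).
move=> [w [Ww hw cw wE]]; have jn' := ltnW jn.
have [_ AB _ _] := ann_chain_stable j full_stable.
have dE : (j.+1%:Z + d) = j%:Z + (1%:Z + d) by rewrite addrA -PoszD addn1.
split=> [[u [[Wu zu] hu uE]]|[m' hm' mm']].
  (* The cocycle w - u comes from some m', and m - z_j m' then corresponds to z_j w - z_j (w - u) =
     z_j u = 0. *)
  have [|||m' cm'] := @connected_surj j d (w - u) jn'.
  - exact: AB.
  - exact: gm_degB.
  - by rewrite linearB uE wE subrr.
  have [_ _ _ hm'] := connected_cocycle cm'.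
  exists m'; first by rewrite dE addrCA [1%:Z + _]addrC addrK.
  have := connectedB cw (connectedZ (hz j) cm').
  rewrite scalerBr zu subr0 subrr => /(IH _ _ _ jn')[+ _]; rewrite -dE; apply.
  exact/bd0/ann_chain_stable/full_stable.
have [|w' cw'] := @connected_total j d m' jn'.
  by move: hm'; rewrite dE addrCA [1%:Z + _]addrC addrK.
have [Ww' hw' dw' _] := connected_cocycle cw'.
have /(IH _ _ _ jn')[_] := connectedB cw (connectedZ (hz j) cw').
rewrite -dE => /(_ mm'); rewrite -scalerBr.
have hA := ann_chain_stable j full_stable; have hd := full_div jn.
move=> /(bd_mul_lift hA hd (AB _ _ _ Ww Ww') (gm_degB hw hw'))[u [Au hu uE]].
by exists u; split=> //; rewrite uE linearB dw' subr0.
Qed.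

Lemma mul_inj_in_zM j d : (j < n)%N ->
  mul_inj (ann_chain full j) (z j) j d <->
  (forall m : M, gm_deg (j%:Z + d) m ->
    in_zM j (1%:Z + (j%:Z + d)) (z j *: m) -> in_zM j (j%:Z + d) m).
Proof.
move=> jn; split=> [hi m hm|hi x Wx hx dx].
  have [x cx] := connected_total (ltnW jn) hm.
  have [Wx hx dx _] := connected_cocycle cx.
  rewrite -(connected_bd (ltnW jn) cx) addrCA.
  rewrite -(connected_bd (ltnW jn) (connectedZ (hz j) cx)); exact: hi.
have [m cx] := connected_surj (ltnW jn) Wx hx dx.
have [_ _ _ hm] := connected_cocycle cx.
rewrite (connected_bd (ltnW jn) cx) (connected_bd (ltnW jn) (connectedZ (hz j) cx)).
by rewrite addrCA; exact: hi.
Qed.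

Lemma van_in_zM j d : (j <= n)%N ->
  van (ann_chain full j) j d <->
  (forall m : M, gm_deg (j%:Z + d) m -> in_zM j (j%:Z + d) m).
Proof.
move=> jn; split=> [hv m hm|hi x Wx hx dx].
  have [x cx] := connected_total jn hm.
  have [Wx hx dx _] := connected_cocycle cx.
  by rewrite -(connected_bd jn cx); exact: hv.
have [m cx] := connected_surj jn Wx hx dx.
have [_ _ _ hm] := connected_cocycle cx.
by rewrite (connected_bd jn cx); exact: hi.
Qed.

(** The shift from c j to c j + j is that of the isomorphism given by [connected]. The right-hand
    side depends on M and z alone, not on the resolution. *)
Lemma lc_vanishing_criterion (c : nat -> int) t :
  (forall i, c i <= c i.+1 + 1) -> (t <= n)%N ->
  (exists D : int, forall j, (j < n)%N -> forall d : int, D < d ->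
    forall m : M, gm_deg d m ->
      in_zM j (1%:Z + d) (z j *: m) -> in_zM j d m) ->
  (forall i, (i <= t)%N -> forall d : int, c i < d ->
    @lc_cocycle k n M E i d `<=` @lc_coboundary k n M E i) <->
  (forall j, (j < n)%N -> (j <= t)%N -> forall d : int, c j + j%:Z < d ->
    forall m : M, gm_deg d m ->
      in_zM j (1%:Z + d) (z j *: m) -> in_zM j d m) /\
  (t = n -> forall d : int, c n + n%:Z < d ->
    forall m : M, gm_deg d m -> in_zM n d m).
Proof.
move=> hc tn [D hD].
have -> : (forall i, (i <= t)%N -> forall d : int, c i < d ->
    @lc_cocycle k n M E i d `<=` @lc_coboundary k n M E i) <-> van_beyond c t tors.
  by split=> h i it d cd; have := h i it d cd; rewrite tors_vanP.
rewrite (tors_van_full t hc) (full_van_beyond hc tn); last first.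
  exists D => j jn d Dd; apply/(mul_inj_in_zM _ jn); apply: hD => //.
  by apply: lt_le_trans Dd _; rewrite lerDr.
split=> -[h1 h2]; split=> [j jn jt d cd|tE d cd].
- have := h1 j jn jt (d - j%:Z); rewrite mul_inj_in_zM // [j%:Z + _]addrC subrK.
  by apply; rewrite ltrBrDr.
- have := h2 tE (d - n%:Z); rewrite van_in_zM // [n%:Z + _]addrC subrK.
  by apply; rewrite ltrBrDr.
- by rewrite mul_inj_in_zM //; apply: h1; rewrite // addrC ltrD2l.
- by rewrite van_in_zM //; apply: h2; rewrite // addrC ltrD2l.
Qed.

End Complex.

(** * Monomials in the last variables *)

Section ReverseVariables.
Variables (k : fieldType) (n : nat).
Local Notation S := {mpoly k[n]}.

(* The variables counted from the last one, as in the filter-regular sequence *)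
(* x_n, x_(n-1), .., x_1. *)
Definition revX (j : nat) : S :=
  if insub j is Some i then 'X_(@rev_ord n i) else 0.

(* The monomials divisible by one of the last j variables. *)
Definition in_last (j : nat) (m : 'X_{1..n}) : bool :=
  [exists i : 'I_n, (n <= i + j)%N && (m i != 0%N)].

Lemma revXE (j : 'I_n) : revX j = 'X_(rev_ord j).
Proof. by rewrite /revX valK. Qed.

Lemma revX_homog j : revX j \is 1.-homog.
Proof.
rewrite /revX; case: insubP => [i _ _|_]; last exact: dhomog0.
by rewrite dhomogX; apply/eqP; exact: mdeg1.
Qed.

Lemma in_lastP (j : nat) (m : 'X_{1..n}) : (j <= n)%N ->
  reflect (exists2 l : 'I_n, (l < j)%N & m (rev_ord l) != 0%N) (in_last j m).
Proof.
move=> jn; apply: (iffP existsP) => [[i /andP[ij mi]]|[l lj ml]].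
  exists (rev_ord i); last by rewrite rev_ordK.
  by rewrite /= ltn_subLR ?ltn_ord // addnC addnS ltnS addnC.
exists (rev_ord l); rewrite ml andbT /=.
by have := ltn_ord l; lia.
Qed.

Lemma in_lastDl j m m' : in_last j m -> in_last j (m' + m)%MM.
Proof.
move=> /existsP[i /andP[ij mi]]; apply/existsP; exists i; rewrite ij mnmDE.
by rewrite addn_eq0 negb_and mi orbT.
Qed.

(** The variable with index [rev_ord j] is the first one counted from the end that is not among the
    last j, so it is a nonzerodivisor modulo them. *)
Lemma in_lastU (j : 'I_n) m : in_last j (U_(rev_ord j) + m)%MM = in_last j m.
Proof.
apply/idP/idP => [/existsP[i /andP[ij]]|]; last exact: in_lastDl.
rewrite mnmDE mnm1E; case: (rev_ord j =P i) => [E|_ mi]; last first.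
  by apply/existsP; exists i; apply/andP; split.
by move: ij; rewrite -E /=; have := ltn_ord j; lia.
Qed.

Lemma in_last_leU j (l : 'I_n) : (l < j)%N -> in_last j U_(rev_ord l)%MM.
Proof.
move=> lj; apply/existsP; exists (rev_ord l).
by rewrite mnm1E eqxx andbT /=; have := ltn_ord l; lia.
Qed.

Lemma in_last_n (m : 'X_{1..n}) : (0 < mdeg m)%N -> in_last n m.
Proof.
move=> m0; apply/in_lastP => //; apply: contrapT => h.
suff E : m = 0%MM by rewrite E mdeg0 in m0.
apply/mnmP => i; rewrite mnm0E; apply: contrapT => mi; apply: h.
by exists (rev_ord i); [exact: ltn_ord|rewrite rev_ordK; apply/eqP].
Qed.

Definition mon_ideal (P : pred 'X_{1..n}) : set S :=
  [set f | forall m, m \in msupp f -> P m].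

Section MonIdeal.
Variable P : pred 'X_{1..n}.
Hypothesis P_up : forall m m', P m -> P (m' + m)%MM.

Lemma mon_ideal_ideal : is_ideal (mon_ideal P).
Proof.
split=> [m|f g hf hg m|f g hg m]; first by rewrite msupp0.
  by move=> /msuppD_le; rewrite mem_cat => /orP[/hf|/hg].
by move=> /msuppM_le /allpairsP[[m1 m2] /= [_ /hg Pm ->]]; exact: P_up.
Qed.

Lemma mon_ideal_homog (d : nat) f :
  mon_ideal P f -> mon_ideal P (pihomog mdeg d f).
Proof.
move=> hf m; rewrite mcoeff_msupp pihomogE raddf_sum /= => h.
apply: hf; apply: contraNT h => nm; rewrite big_seq_cond big1 // => m' /andP[m'f _].
rewrite mcoeffZ mcoeffX; case: eqP => [E|]; last by rewrite mulr0.
by rewrite -E m'f in nm.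
Qed.

End MonIdeal.

Lemma mon_idealXM P (i : 'I_n) f :
  mon_ideal P ('X_i * f) <-> mon_ideal (fun m => P (U_(i) + m)%MM) f.
Proof.
split=> [h m mf|h m].
  by apply: h; rewrite mulrC (perm_mem (msuppMX _ _)); apply: map_f.
by rewrite mulrC (perm_mem (msuppMX _ _)) => /mapP[m' /h Pm ->].
Qed.

End ReverseVariables.

(** * Linear forms obtained from the variables by a graded automorphism *)

Section Coordinates.
Variables (k : fieldType) (n : nat).
Local Notation S := {mpoly k[n]}.
Variables (phi psi : {lrmorphism S -> S}).
Hypotheses (phiK : cancel phi psi) (psiK : cancel psi phi).
Hypotheses (phi_homog : forall d f, f \is d.-homog -> phi f \is d.-homog).
Hypotheses (psi_homog : forall d f, f \is d.-homog -> psi f \is d.-homog).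

Lemma phi_pihomog d f : phi (pihomog mdeg d f) = pihomog mdeg d (phi f).
Proof.
have -> : pihomog mdeg d (phi f) =
    \sum_(i < mmeasure mdeg f) pihomog mdeg d (phi (pihomog mdeg i f)).
  by rewrite -!raddf_sum -pihomog_sum.
have hi (i : nat) := phi_homog (pihomogP mdeg i f).
have [lt_d|le_d] := ltnP d (mmeasure mdeg f).
  rewrite (bigD1 (Ordinal lt_d)) //= (pihomog_dE (hi d)) big1 ?addr0 // => i ne.
  exact: pihomog_ne0 (hi i).
rewrite big1 => [|i _]; last first.
  apply: pihomog_ne0 (hi i); apply: contraTneq le_d => <-.
  by rewrite -ltnNge ltn_ord.
rewrite (_ : pihomog mdeg d f = 0) ?raddf0 //.
rewrite pihomogE big_seq_cond big1 // => m /andP[/mmeasure_mnm_lt lt_m /eqP md].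
by have := leq_trans (lt_m mdeg) le_d; rewrite md ltnn.
Qed.

Definition lform (j : nat) : S := psi (revX k n j).

Lemma lform_homog j : lform j \is 1.-homog.
Proof. exact/psi_homog/revX_homog. Qed.

Lemma psi_expand (f : S) : f = \sum_(m <- msupp (phi f)) (phi f)@_m *: psi 'X_[m].
Proof.
rewrite -[f in LHS]phiK {1}[phi f]mpolyE raddf_sum; apply: eq_bigr => m _.
exact: linearZ.
Qed.

Lemma psi_expand_ann (M : gradedModule k n) (x : M) f :
  (forall m, m \in msupp (phi f) -> psi 'X_[m] *: x = 0) -> f *: x = 0.
Proof.
move=> h; rewrite (psi_expand f) scaler_suml big_seq big1 // => m /h hm.
by rewrite -mul_mpolyC -scalerA hm scaler0.
Qed.

Fact mon_pullback_ideal (P : pred 'X_{1..n}) : (forall m m', P m -> P (m' + m)%MM) ->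
  is_ideal [set f | mon_ideal P (phi f)].
Proof.
move=> P_up; have hI := @mon_ideal_ideal k n P P_up; split=> /= [|f g hf hg|f g hg].
- by rewrite raddf0; exact: (ideal0 hI).
- by rewrite raddfD; exact: (idealD hI).
- by rewrite rmorphM; exact: (idealM _ hI).
Qed.

Definition mon_pullback (P : pred 'X_{1..n}) (P_up : forall m m', P m -> P (m' + m)%MM) : homogIdeal k n.
Proof.
refine (@HomogIdeal k n [set f | mon_ideal P (phi f)] (mon_pullback_ideal P_up) _).
by move=> d f hf /=; rewrite phi_pihomog; exact: mon_ideal_homog.
Defined.

(** The colon of a monomial ideal by a variable is again monomial, so the annihilator condition of
    [injective_divides] has to be checked on monomials only. *)
Lemma mon_divides (E : gradedModule k n) (P : pred 'X_{1..n}) (i : 'I_n) d (x : E) :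
  graded_injective E -> (forall m m', P m -> P (m' + m)%MM) ->
  gm_deg (1%:Z + d) x ->
  (forall m, P (U_(i) + m)%MM -> psi 'X_[m] *: x = 0) ->
  exists y, [/\ gm_deg d y, psi 'X_i *: y = x & forall m, P m -> psi 'X_[m] *: y = 0].
Proof.
move=> Einj P_up hx ann.
have hz : psi 'X_i \is 1.-homog by apply: psi_homog; rewrite dhomogX; apply/eqP/mdeg1.
have [|y [hy yx yann]] := @injective_divides k n E (mon_pullback P_up) 1 d _ x Einj hz hx.
  move=> s; rewrite /= rmorphM /= psiK => /mon_idealXM h.
  by apply: psi_expand_ann => m /h; exact: ann.
exists y; split=> // m Pm; apply: yann => /=; rewrite psiK => m'.
by move=> /mem_msuppXP <-.
Qed.

Variables (M : gradedModule k n) (E : injResolution M).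

Let full : forall i, set (res_obj E i) := fun _ => setT.
Let tors : forall i, set (res_obj E i) := fun i => @torsion k n (res_obj E i).

Lemma psiX_mem (A : gradedModule k n) (x : A) (l : 'I_n) (m : 'X_{1..n}) :
  m (rev_ord l) != 0%N -> lform l *: x = 0 -> psi 'X_[m] *: x = 0.
Proof.
move=> ml zx; have le_lm : (U_(rev_ord l) <= m)%MM by rewrite lep1mP.
have lE : psi 'X_(rev_ord l) = lform l by rewrite /lform revXE.
by rewrite -(submK le_lm) mpolyXD rmorphM /= -scalerA lE zx scaler0.
Qed.

Lemma psiX_last_ann (A : gradedModule k n) (x : A) j (m : 'X_{1..n}) : (j <= n)%N ->
  (forall l, (l < j)%N -> lform l *: x = 0) -> in_last j m -> psi 'X_[m] *: x = 0.
Proof.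
by move=> jn zx /(in_lastP _ jn)[l lj ml]; apply: (psiX_mem ml); exact: zx.
Qed.

Lemma lform_full_div j : (j < n)%N ->
  divisible (ann_chain lform full j) (lform j).
Proof.
move=> jn i d x /ann_chainP[_ zx] hx.
have up (m m' : 'X_{1..n}) : in_last j m -> in_last j (m' + m)%MM by exact: in_lastDl.
have [m|y [hy yx yann]] := @mon_divides _ _ (rev_ord (Ordinal jn)) d x (@res_objP k n M E i) up hx.
  by rewrite (in_lastU (Ordinal jn)); exact: psiX_last_ann (ltnW jn) zx.
exists y; split=> //; last by rewrite /lform -[j]/(nat_of_ord (Ordinal jn)) revXE.
apply/ann_chainP; split=> // l lj; have ln := ltn_trans lj jn.
rewrite /lform -[l]/(nat_of_ord (Ordinal ln)) revXE; apply: yann.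
exact: in_last_leU.
Qed.

Lemma lform_tors_div j : (j < n)%N ->
  divisible (ann_chain lform tors j) (lform j).
Proof.
move=> jn i d x /ann_chainP[/torsionP[r hr] zx] hx.
(* Adding the monomials of degree > r to the ideal forces the quotient y to be torsion. This is
   compatible with z_j y = x since x is killed in degrees >= r, one less. *)
pose P (m : 'X_{1..n}) := in_last j m || (r < mdeg m)%N.
have up (m m' : 'X_{1..n}) : P m -> P (m' + m)%MM.
  move=> /orP[h|h]; apply/orP; first by left; exact: in_lastDl.
  by right; rewrite mdegD; apply: leq_trans h (leq_addl _ _).
have [m|y [hy yx yann]] := @mon_divides _ _ (rev_ord (Ordinal jn)) d x (@res_objP k n M E i) up hx.
  rewrite /P (in_lastU (Ordinal jn)) mdegD mdeg1 add1n ltnS => /orP[|h].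
    exact: psiX_last_ann (ltnW jn) zx.
  by apply: (hr (mdeg m)) => //; apply: psi_homog; rewrite dhomogX.
exists y; split=> //; last by rewrite /lform -[j]/(nat_of_ord (Ordinal jn)) revXE.
apply/ann_chainP; split=> [|l lj].
  apply/torsionP; exists r.+1 => e f re /phi_homog /dhomogP hf.
  by apply: psi_expand_ann => m /hf /= me; apply: yann; rewrite /P me re orbT.
have ln := ltn_trans lj jn.
rewrite /lform -[l]/(nat_of_ord (Ordinal ln)) revXE; apply: yann.
by apply/orP; left; exact: in_last_leU.
Qed.

Lemma lform_ann_tors (A : gradedModule k n) (x : A) :
  (forall l, (l < n)%N -> lform l *: x = 0) -> torsion x.
Proof.
move=> zx; apply/torsionP; exists 1%N => e f e1 /phi_homog /dhomogP hf.
apply: psi_expand_ann => m /hf /= me.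
by apply: (psiX_last_ann (leqnn n) zx); apply: in_last_n; rewrite me.
Qed.

End Coordinates.

(** * The vanishing criterion for ideals *)

Section IdealCriterion.
Variables (k : fieldType) (n : nat).
Local Notation S := {mpoly k[n]}.

Fixpoint in_xI (I : set S) (j : nat) (f : S) : Prop :=
  if j is l.+1 then exists2 g, I g & in_xI I l (f - revX k n l * g) else f = 0.

Lemma in_xI_homog (I : homogIdeal k n) j (d : nat) f :
  in_xI (hideal_set I) j f -> in_xI (hideal_set I) j (pihomog mdeg d f).
Proof.
elim: j f => [|j IH] f /=; first by move=> ->; rewrite raddf0.
move=> [g Ig /IH]; rewrite raddfB /= (pihomogMl _ _ (revX_homog _ _ j)).
case: leqP => [_ h|_ h]; last first.
  by exists (pihomog mdeg (d - 1) g); [apply: hideal_homog|exact: h].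
by exists 0; [exact: hideal0|rewrite mulr0].
Qed.

(** Injectivity of [revX j] in degree e on I modulo the products of I with the last j variables. *)
Definition regular_at (I : set S) (j e : nat) : Prop :=
  forall f, I f -> f \is e.-homog -> in_xI I j (revX k n j * f) -> in_xI I j f.

(** For j = n: the ideal has no minimal generators of degree e. *)
Definition generated_at (I : set S) (j e : nat) : Prop :=
  forall f, I f -> f \is e.-homog -> in_xI I j f.

Variables (I I' : homogIdeal k n) (phi psi : {lrmorphism S -> S}).
Hypotheses (phiK : cancel phi psi) (psiK : cancel psi phi).
Hypotheses (phi_homog : forall d f, f \is d.-homog -> phi f \is d.-homog).
Hypotheses (psi_homog : forall d f, f \is d.-homog -> psi f \is d.-homog).
Hypothesis phiI : forall f, hideal_set I f <-> hideal_set I' (phi f).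

Let z := lform psi.
Let M := ideal_module I.

Lemma in_zM_xI j (e : nat) (m : M) : gm_deg e%:Z m ->
  in_zM z j e%:Z m <-> in_xI (hideal_set I') j (phi (ideal_val m)).
Proof.
elim: j m => [|j IH] m hm /=.
  split=> [->|h]; first exact: raddf0.
  by apply/val_inj/(can_inj phiK); rewrite h raddf0.
split=> [[m' hm' /IH h]|[g I'g h]].
  exists (phi (ideal_val m')); first by apply/phiI; case: (m') => f /= /asboolP.
  have : gm_deg e%:Z (m - z j *: m').
    by apply: gm_degB => //; rewrite -[e%:Z](subrKC 1); apply: gm_degZ => //; exact: lform_homog.
  move=> /h; congr in_xI; rewrite [ideal_val _](_ : _ = ideal_val m - z j * ideal_val m') //.
  by rewrite raddfB /= rmorphM /= psiK.
(* [in_xI] puts no degree on the cofactor, [in_zM] asks for degree e - 1. Its part of that degree is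
   taken, which is 0 when e = 0. *)
have [g' [I'g' hg' h']] : exists g', [/\ hideal_set I' g',
    (if e is b.+1 then g' \is b.-homog else g' = 0)
    & in_xI (hideal_set I') j (phi (ideal_val m) - revX k n j * g')].
  have := in_xI_homog e h; rewrite raddfB /= (pihomogMl _ _ (revX_homog _ _ j)).
  rewrite pihomog_dE; last exact: phi_homog.
  case: (e) => [|b] /=; last first.
    rewrite subn1 /= => h'; exists (pihomog mdeg b g); split=> //; last exact: pihomogP.
    exact: hideal_homog.
  by move=> h'; exists 0; rewrite mulr0; split=> //; exact: hideal0.
have mem : (psi g' : S^o) \in hideal_pred I by apply/asboolP/phiI; rewrite psiK.
pose m' : M := IdealElt mem.
have hm' : gm_deg (e%:Z - 1) m'.
  case: (e) hg' => [|b] hg'; first by apply/val_inj; rewrite /= hg' raddf0.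
  by rewrite -addn1 PoszD addrK; exact: psi_homog.
exists m' => //; apply/IH.
  by apply: gm_degB => //; rewrite -[e%:Z](subrKC 1); apply: gm_degZ => //; exact: lform_homog.
move: h'; congr in_xI; rewrite [ideal_val (m - _)](_ : _ = ideal_val m - z j * ideal_val m') //.
by rewrite raddfB /= rmorphM /= !psiK.
Qed.

Lemma in_zM0 j (d : int) : in_zM z j d (0 : M).
Proof.
elim: j => [//|j IH] /=; exists 0; first exact: ideal_deg0.
by rewrite scaler0 subr0.
Qed.

Lemma phi_lform_mul j (m : M) :
  phi (ideal_val (z j *: m)) = revX k n j * phi (ideal_val m).
Proof.
rewrite [ideal_val _](_ : _ = z j * ideal_val m) //.
by rewrite rmorphM /= psiK.
Qed.

Lemma ideal_elt_lift f d : hideal_set I' f -> f \is d.-homog ->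
  exists2 m : M, gm_deg d%:Z m & phi (ideal_val m) = f.
Proof.
move=> I'f hf; have mem : (psi f : S^o) \in hideal_pred I.
  by apply/asboolP/phiI; rewrite psiK.
by exists (IdealElt mem : M); [exact: psi_homog|exact: psiK].
Qed.

Lemma regular_atP j e : regular_at (hideal_set I') j e <->
  (forall m : M, gm_deg e%:Z m ->
    in_zM z j (1%:Z + e%:Z) (z j *: m) -> in_zM z j e%:Z m).
Proof.
split=> h.
  move=> m hm; rewrite -PoszD in_zM_xI; last first.
    by rewrite PoszD; apply: gm_degZ => //; exact: lform_homog.
  rewrite in_zM_xI // phi_lform_mul; apply: h; last exact: phi_homog.
  by apply/phiI; case: (m) => f fI; apply: asboolW fI.
move=> f I'f hf; have [m hm <-] := ideal_elt_lift I'f hf.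
have hzm : gm_deg (1 + e)%N%:Z (z j *: m).
  by rewrite PoszD; apply: gm_degZ => //; exact: lform_homog.
rewrite -phi_lform_mul -(in_zM_xI j hzm) -(in_zM_xI j hm); exact: h.
Qed.

Lemma generated_atP j e : generated_at (hideal_set I') j e <->
  (forall m : M, gm_deg e%:Z m -> in_zM z j e%:Z m).
Proof.
split=> h.
  move=> m hm; rewrite in_zM_xI //; apply: h; last exact: phi_homog.
  by apply/phiI; case: (m) => f fI; apply: asboolW fI.
move=> f I'f hf; have [m hm <-] := ideal_elt_lift I'f hf.
by rewrite -(in_zM_xI j hm); exact: h.
Qed.

Lemma ideal_lc_criterion (c : nat -> int) t :
  (forall i, c i <= c i.+1 + 1) -> (t <= n)%N ->
  (exists D : nat, forall j, (j < n)%N -> forall e, (D < e)%N ->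
    regular_at (hideal_set I') j e) ->
  (forall i, (i <= t)%N -> forall d : int, c i < d -> ~ lc_neq0 M i d) <->
  (forall j, (j < n)%N -> (j <= t)%N -> forall e : nat, c j + j%:Z < e%:Z ->
    regular_at (hideal_set I') j e) /\
  (t = n -> forall e : nat, c n + n%:Z < e%:Z -> generated_at (hideal_set I') n e).
Proof.
move=> hc tn [D hD].
have crit E := @lc_vanishing_criterion k n M E z (lform_homog psi_homog)
  (lform_full_div phiK psiK phi_homog psi_homog (E := E))
  (lform_tors_div phiK psiK phi_homog psi_homog (E := E))
  (fun i => @lform_ann_tors k n phi psi phiK phi_homog _) c t hc tn.
have {}crit : forall E : injResolution M,
    (forall i, (i <= t)%N -> forall d : int, c i < d ->
      @lc_cocycle k n M E i d `<=` @lc_coboundary k n M E i) <->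
    (forall j, (j < n)%N -> (j <= t)%N -> forall e : nat, c j + j%:Z < e%:Z ->
      regular_at (hideal_set I') j e) /\
    (t = n -> forall e : nat, c n + n%:Z < e%:Z -> generated_at (hideal_set I') n e).
  move=> E; rewrite crit; last first.
    exists D%:Z => j jn [e|e] De m hm //.
    by have /regular_atP h := hD j jn e De; exact: h.
  split=> -[h1 h2]; split=> [j jn jt|tE].
  - by move=> e ce; apply/regular_atP; exact: h1.
  - by move=> e ce; apply/generated_atP; exact: h2.
  - move=> [e|e] ce m hm; first by have /regular_atP h := h1 j jn jt e ce; exact: h.
    by move: hm => /= -> _; exact: in_zM0.
  - move=> [e|e] ce m hm; first by have /generated_atP h := h2 tE e ce; exact: h.
    by move: hm => /= ->; exact: in_zM0.
have [E0 _] := exists_injResolution M.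
(* The resolution [E0] serves one direction. For the other, vanishing for [E0] is turned into the
   conditions on the ideal and from there into vanishing for the given E. *)
rewrite -(crit E0); split=> h i it d cd.
  by move=> x hx; apply: contrapT => nx; apply: (h i it d cd); exists E0 => /(_ x hx).
move=> [E]; apply; move: h; rewrite (crit E0) -(crit E) => h; exact: h.
Qed.

End IdealCriterion.

(** * Colon conditions *)

Section ColonConditions.
Variables (k : fieldType) (n : nat).
Local Notation S := {mpoly k[n]}.
Local Notation x := (revX k n).
Local Notation Q j := (@mon_ideal k n (@in_last n j)).

Lemma last_ideal j : is_ideal (Q j).
Proof. apply: mon_ideal_ideal => m m'; exact: in_lastDl. Qed.

Lemma last_ideal0 f : Q 0 f -> f = 0.
Proof.
move=> hf; rewrite [f]mpolyE big_seq big1 // => m /hf /in_lastP.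
by case=> // -[].
Qed.

Lemma last_idealXM j f : (j < n)%N -> Q j (x j * f) -> Q j f.
Proof.
move=> jn; rewrite -[j in x j]/(nat_of_ord (Ordinal jn)) revXE.
by move=> /mon_idealXM h m /h; rewrite (in_lastU (Ordinal jn)).
Qed.

Lemma last_idealS j f : (j < n)%N -> Q j f -> Q j.+1 f.
Proof.
move=> jn h m /h /existsP[i /andP[ij mi]]; apply/existsP; exists i.
by rewrite mi andbT addnS; exact: leqW.
Qed.

Lemma last_idealX j : (j < n)%N -> Q j.+1 (x j).
Proof.
move=> jn; rewrite -[j in x j]/(nat_of_ord (Ordinal jn)) revXE => m.
by move=> /mem_msuppXP <-; exact: in_last_leU.
Qed.

Lemma last_ideal_split j f : (j < n)%N -> Q j.+1 f -> exists g, Q j (f - x j * g).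
Proof.
move=> jn hf; rewrite -[j in x j]/(nat_of_ord (Ordinal jn)) revXE.
set i := rev_ord _.
have ex m : m \in msupp f -> exists g, Q j (f@_m *: 'X_[m] - 'X_i * g).
  move=> /hf; case: (boolP (in_last j m)) => [hm _|nm].
    exists 0; rewrite mulr0 subr0; apply: (idealZ _ (last_ideal j)) => m'.
    by move=> /mem_msuppXP <-.
  move=> /(in_lastP _ jn)[l]; rewrite ltnS leq_eqVlt => /orP[/eqP lj|lj] ml; last first.
    case/negP: nm; apply/in_lastP; first exact: ltnW.
    by exists l.
  have le_im : (U_(i) <= m)%MM.
    by rewrite lep1mP /i (_ : Ordinal jn = l) //; apply: val_inj.
  exists (f@_m *: 'X_[m - U_(i)]); rewrite -scalerAr -mpolyXD addmC submK // subrr.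
  apply: ideal0; exact: last_ideal.
have {ex}/choice[g hg] : forall m, exists g, m \in msupp f ->
    Q j (f@_m *: 'X_[m] - 'X_i * g).
  move=> m; case: (boolP (m \in msupp f)) => [/ex[g hg]|]; first by exists g.
  by exists 0.
exists (\sum_(m <- msupp f) g m).
rewrite {1}[f]mpolyE mulr_sumr -sumrB; apply: (ideal_sum_closed (last_ideal j)) => m.
exact: hg.
Qed.

Lemma last_ideal_split_homog j e f : (j < n)%N -> Q j.+1 f -> f \is e.-homog ->
  Q j f \/ exists b g, [/\ e = b.+1, g \is b.-homog & Q j (f - x j * g)].
Proof.
move=> jn /(last_ideal_split jn)[g hg] hf.
have := @mon_ideal_homog k n _ e _ hg; rewrite raddfB /= (pihomog_dE hf).
rewrite (pihomogMl _ _ (revX_homog _ _ j)); case: e hf => [|b] hf /=.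
  by rewrite subr0; left.
rewrite subn1 /= => h; right; exists b, (pihomog mdeg b g); split=> //.
exact: pihomogP.
Qed.

Variable I : homogIdeal k n.
Local Notation hI := (hideal_ideal I).

Lemma in_xI_last j f : (j <= n)%N -> in_xI (hideal_set I) j f -> Q j f.
Proof.
elim: j f => [|j IH] f jn /=; first by move=> ->; apply: ideal0; exact: last_ideal.
move=> [g Ig /(IH _ (ltnW jn)) h]; rewrite -[f](subrK (x j * g)).
apply: (idealD (last_ideal _)); first exact: last_idealS.
by rewrite mulrC; apply: (idealM _ (last_ideal _)); exact: last_idealX.
Qed.

Lemma in_xI_homog_witness j e f : in_xI (hideal_set I) j.+1 f -> f \is e.-homog ->
  in_xI (hideal_set I) j f \/
  exists b g, [/\ e = b.+1, hideal_set I g, g \is b.-homog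
    & in_xI (hideal_set I) j (f - x j * g)].
Proof.
move=> [g Ig h] hf; have := in_xI_homog e h; rewrite raddfB /= (pihomog_dE hf).
rewrite (pihomogMl _ _ (revX_homog _ _ j)); case: e hf => [|b] hf /=.
  by rewrite subr0; left.
rewrite subn1 /= => h'; right; exists b, (pihomog mdeg b g); split=> //.
  exact: hideal_homog.
exact: pihomogP.
Qed.

Definition sum_last (I : set S) j : set S := [set f | exists2 i, I i & Q j (f - i)].

(* x_j is a nonzerodivisor on S / (I + Q_j) in degree e. *)
Definition colon_at (I : set S) j e : Prop :=
  forall g, g \is e.-homog -> sum_last I j (x j * g) -> sum_last I j g.

(** Tor_1(S/I, S/Q_j)_e = 0, that is, I meet Q_j is contained in Q_j I in degree e. It mediates
    between [regular_at] and [colon_at]. *)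
Definition meet_at (I : set S) j e : Prop :=
  forall f, f \is e.-homog -> I f -> Q j f -> in_xI I j f.

Lemma sum_last_homog_witness j e f : f \is e.-homog -> sum_last (hideal_set I) j f ->
  exists2 i, hideal_set I i /\ i \is e.-homog & Q j (f - i).
Proof.
move=> hf [i Ii h]; exists (pihomog mdeg e i).
  by split; [exact: hideal_homog|exact: pihomogP].
by have := @mon_ideal_homog k n _ e _ h; rewrite raddfB /= (pihomog_dE hf).
Qed.

(** For f = x_j g + q in I with q in Q_j, the colon condition replaces g by some i in I modulo Q_j;
    then f - x_j i lies in I meet Q_j, where induction applies. The factor g has degree e - 1. *)
Lemma colon_meet j e : (j <= n)%N ->
  (forall l b, (l < j)%N -> e = b.+1 -> colon_at (hideal_set I) l b) ->
  meet_at (hideal_set I) j e.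
Proof.
elim: j => [|j IH] jn hc f hf If; first exact: last_ideal0.
have {}IH : meet_at (hideal_set I) j e.
  by apply: IH => [|l b lj]; [exact: ltnW|apply: hc; exact: ltnW].
move=> /(last_ideal_split_homog jn) /(_ hf) [h|[b [g [eb hg h]]]].
  exists 0; first exact: hideal0.
  by rewrite mulr0 subr0; exact: IH.
have [||i [Ii hi] gi] := @sum_last_homog_witness j b g; first exact: hg.
  apply: (hc j b (ltnSn j) eb) => //; exists f => //.
  by rewrite -opprB; apply: (idealN (last_ideal j)).
exists i => //; apply: IH.
- apply: rpredB => //; rewrite eb -add1n; apply: dhomogM => //; exact: revX_homog.
- by apply: (idealB hI) => //; exact: (idealM _ hI).
- rewrite (_ : f - x j * i = (f - x j * g) + x j * (g - i)); last by ring.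
  by apply: (idealD (last_ideal j)) => //; exact: (idealM _ (last_ideal j)).
Qed.

(** If x_j g is congruent to i in I modulo Q_j, then i lies in I meet Q_(j+1), hence in Q_(j+1) I;
    comparing the multiples of x_j modulo Q_j puts g in I + Q_j. *)
Lemma meet_colon j e : (j < n)%N ->
  meet_at (hideal_set I) j.+1 e.+1 -> colon_at (hideal_set I) j e.
Proof.
move=> jn hm g hg /(@sum_last_homog_witness j e.+1 (x j * g))[|i [Ii hi] gi].
  by rewrite -add1n; apply: dhomogM => //; exact: revX_homog.
have Qi : Q j.+1 i.
  rewrite -[i](subKr (x j * g)); apply: (idealB (last_ideal _)).
    by rewrite mulrC; apply: (idealM _ (last_ideal _)); exact: last_idealX.
  exact: last_idealS.
have [i' Ii' h] := hm i hi Ii Qi.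
exists i' => //; apply: (last_idealXM jn).
rewrite (_ : x j * (g - i') = (x j * g - i) + (i - x j * i')); last by ring.
by apply: (idealD (last_ideal j)) => //; apply: in_xI_last h; exact: ltnW.
Qed.

(** Where I meet Q_j = Q_j I, the quotient I/Q_j I embeds into S/Q_j, on which x_j is a
    nonzerodivisor. *)
Lemma meet_regular j e : (j < n)%N ->
  meet_at (hideal_set I) j e -> regular_at (hideal_set I) j e.
Proof.
move=> jn hm f If hf /(in_xI_last (ltnW jn)) /(last_idealXM jn); exact: hm.
Qed.

(** Multiplication by x_j^(D+1) carries f beyond degree D, where it lies in Q_j I; regularity in
    degrees >= e then cancels the factors x_j one at a time. *)
Lemma regular_meet j e : (j < n)%N ->
  (forall e', (e <= e')%N -> regular_at (hideal_set I) j e') ->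
  (exists D : nat, forall e', (D < e')%N -> meet_at (hideal_set I) j e') ->
  meet_at (hideal_set I) j e.
Proof.
move=> jn hr [D hD] f hf If Qf.
have descend N e' g : (e <= e')%N -> hideal_set I g -> g \is e'.-homog ->
    in_xI (hideal_set I) j (x j ^+ N * g) -> in_xI (hideal_set I) j g.
  elim: N e' g => [|N IH] e' g ee' Ig hg; first by rewrite expr0 mul1r.
  rewrite exprSr -mulrA => h; apply: (hr e' ee') => //.
  apply: (IH e'.+1) => //; first exact: leqW.
    exact: (idealM _ hI).
  by rewrite -add1n; apply: dhomogM => //; exact: revX_homog.
apply: (descend D.+1 e) => //; apply: (hD (D.+1 + e)%N).
- by rewrite addSn ltnS leq_addr.
- by apply: dhomogM => //; have := dhomogMn D.+1 (revX_homog k n j); rewrite mul1n.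
- exact: (idealM _ hI).
- exact: (idealM _ (last_ideal j)).
Qed.

(** Graded Nakayama: cofactors have smaller degree and vanish by induction. *)
Lemma generated_zero f :
  (forall e, generated_at (hideal_set I) n e) -> hideal_set I f -> f = 0.
Proof.
move=> hg; have hom e g : g \is e.-homog -> hideal_set I g -> g = 0.
  have [m] := ubnP e; elim: m e g => // m IH e g; rewrite ltnS => em hge Ig.
  have : in_xI (hideal_set I) n g by exact: (hg e).
  move: (n in in_xI _ n) => j; elim: j => [//|j IHj].
  move=> /in_xI_homog_witness /(_ hge)[//|[b [g' [eb Ig' hg' h]]]].
  by apply: IHj; move: h; rewrite (IH b g') ?mulr0 ?subr0 // -eb.
move=> If; rewrite [f]pihomog_sum big1 // => i _.
by apply: (hom i); [exact: pihomogP|exact: hideal_homog].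
Qed.

Lemma last_ideal_pos e f : f \is e.+1.-homog -> Q n f.
Proof. by move=> /dhomogP hf m /hf /= me; apply: in_last_n; rewrite me. Qed.

Hypothesis filter_regular : exists D : nat, forall j, (j < n)%N ->
  forall e, (D < e)%N -> colon_at (hideal_set I) j e.

Lemma meet_large : exists D : nat, forall j, (j <= n)%N ->
  forall e, (D < e)%N -> meet_at (hideal_set I) j e.
Proof.
have [D hD] := filter_regular; exists D.+1 => j jn e De; apply: colon_meet => //.
by move=> l b lj eb; apply: hD; [exact: leq_trans lj jn|rewrite eb in De].
Qed.

Lemma regular_large : exists D : nat, forall j, (j < n)%N ->
  forall e, (D < e)%N -> regular_at (hideal_set I) j e.
Proof.
have [D hD] := meet_large; exists D => j jn e De; apply: meet_regular => //.
by apply: hD => //; exact: ltnW.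
Qed.

(** The colon condition for l is read off from [meet_at] for l + 1 in degree e + 1, whence [c l.+1]
    and l < t. In positive degrees [generated_at] and [meet_at] agree for j = n; in degree 0 they
    differ, as nonzero constants lie outside Q_n, and this leaves the clause on I = 0. *)
Lemma colon_criterion (c : nat -> int) t :
  (forall i, c i <= c i.+1 + 1) -> (t <= n)%N ->
  ((forall j, (j < n)%N -> (j <= t)%N -> forall e : nat, c j + j%:Z < e%:Z ->
      regular_at (hideal_set I) j e) /\
   (t = n -> forall e : nat, c n + n%:Z < e%:Z -> generated_at (hideal_set I) n e))
  <->
  ((forall l, (l < n)%N -> (l < t)%N -> forall e : nat, c l.+1 + l%:Z < e%:Z ->
      colon_at (hideal_set I) l e) /\
   (t = n -> c n + n%:Z < 0 -> forall f, hideal_set I f -> f = 0)).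
Proof.
move=> hc tn; split=> -[h1 h2].
  split=> [l ln lt e ce|tE cn f]; last first.
    by apply: generated_zero => e; apply: h2 => //; apply: lt_le_trans cn _.
  have ce1 : c l.+1 + l.+1%:Z < e.+1%:Z by lia.
  (* For l + 1 = n there is no further variable to be regular; t = n is then forced and
     [generated_at] takes over. *)
  apply: meet_colon => //; have := ln; rewrite leq_eqVlt => /orP[/eqP lE|ln'].
    have tE : t = n by apply/eqP; rewrite eqn_leq tn -lE.
    move=> f hf If _; rewrite lE in ce1 *; exact: (h2 tE _ ce1).
  apply: regular_meet => // [e' ee'|]; first by apply: h1 => //; lia.
  by have [D hD] := meet_large; exists D => e'; exact: hD.
have mono l j : (l <= j)%N -> c l + l%:Z <= c j + j%:Z.
  move=> /subnKC <-; elim: (j - l)%N => [|m IH]; first by rewrite addn0.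
  by apply: le_trans IH _; have := hc (l + m)%N; rewrite addnS; lia.
have meet j e : (j <= n)%N -> (j <= t)%N -> c j + j%:Z < e%:Z ->
    meet_at (hideal_set I) j e.
  move=> jn jt ce; apply: colon_meet => // l b lj eb; apply: h1.
  - exact: leq_trans lj jn.
  - exact: leq_trans lj jt.
  - by have := mono _ _ lj; lia.
split=> [j jn jt e ce|tE e ce].
  by apply: meet_regular => //; apply: meet => //; exact: ltnW.
move=> f If hf; have [cn|cn] := ltP (c n + n%:Z) 0.
  by rewrite (h2 tE cn f If); elim: (n in in_xI _ n) => // j IH; exists 0;
    [exact: hideal0|rewrite mulr0 subr0].
apply: (meet n e); rewrite ?tE //.
(* Degree 0 is excluded by c n + n >= 0, so f has positive degree and lies in Q_n. *)
by case: e ce hf => [|e] ce; [lia|exact: last_ideal_pos].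
Qed.

End ColonConditions.

(** * Reverse lexicographic initial ideals *)

Section RevLex.
Variable n : nat.
Implicit Types m : 'X_{1..n}.

Lemma revlex_irr m : ~ revlex_lt m m.
Proof. by case=> [|[_ [i [+ _]]]]; rewrite ltnn. Qed.

Lemma revlex_trans m1 m2 m3 : revlex_lt m1 m2 -> revlex_lt m2 m3 -> revlex_lt m1 m3.
Proof.
case=> [d12|[d12 [i [i12 hi]]]] [d23|[d23 [j [j23 hj]]]].
- by left; exact: ltn_trans d12 d23.
- by left; rewrite -d23.
- by left; rewrite d12.
right; split; first by rewrite d12.
have [ij|ji|/val_inj ij] := ltngtP i j.
- exists j; split; first by rewrite (hi j ij).
  by move=> l jl; rewrite (hi l (ltn_trans ij jl)) (hj l jl).
- exists i; split; first by rewrite -(hj i ji).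
  by move=> l il; rewrite (hi l il) (hj l (ltn_trans ji il)).
- exists i; split; first by apply: ltn_trans i12; rewrite ij.
  by move=> l il; rewrite (hi l il) (hj l) // -ij.
Qed.

Lemma revlex_total m1 m2 : m1 != m2 -> revlex_lt m1 m2 \/ revlex_lt m2 m1.
Proof.
move=> ne; have [d|d|d] := ltngtP (mdeg m1) (mdeg m2); [by left; left|by right; left|].
have [i0 hi0] : exists i, m1 i != m2 i.
  apply: contrapT => h; case/eqP: ne; apply/mnmP => i; apply: contrapT => hi.
  by apply: h; exists i; apply/eqP.
have [i hi imax] := @arg_maxnP 'I_n i0 (fun i => m1 i != m2 i) (@nat_of_ord n) hi0.
have hlast (l : 'I_n) : (i < l)%N -> m1 l = m2 l.
  by move=> il; apply: contrapT => /eqP /imax; rewrite /= leqNgt il.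
move: hi; rewrite neq_ltn => /orP[hi|hi].
  by right; right; split=> //; exists i; split=> // l il; rewrite hlast.
by left; right; split=> //; exists i; split.
Qed.

Lemma revlex_add m m1 m2 : revlex_lt (m + m1)%MM (m + m2)%MM <-> revlex_lt m1 m2.
Proof.
rewrite /revlex_lt !mdegD ltn_add2l; split=> -[h|[h [i [hi hl]]]]; try by left.
  right; split; first exact: addnI h.
  exists i; move: hi; rewrite !mnmDE ltn_add2l; split=> // l /hl.
  by rewrite !mnmDE => /addnI.
right; split; first by rewrite h.
by exists i; rewrite !mnmDE ltn_add2l; split=> // l /hl E; rewrite !mnmDE E.
Qed.

(** The property that singles out this order: a homogeneous f whose leading monomial lies in Q_j
    lies in Q_j itself. *)
Lemma revlex_in_last j m1 m2 :
  mdeg m1 = mdeg m2 -> revlex_lt m1 m2 -> in_last j m2 -> in_last j m1.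
Proof.
move=> d [|[_ [i [hi hl]]]]; first by rewrite d ltnn.
move=> /existsP[p /andP[jp m2p]]; apply/existsP.
have [ip|pi] := ltnP i p; first by exists p; rewrite jp hl.
exists i; rewrite (leq_trans jp) ?leq_add2r //=.
by rewrite -lt0n; apply: leq_ltn_trans hi.
Qed.

Lemma in_last_revlex j m1 m2 : mdeg m1 = mdeg m2 ->
  in_last j m1 -> ~~ in_last j m2 -> revlex_lt m1 m2.
Proof.
move=> d h1 h2; have ne : m1 != m2 by apply: contraNneq h2 => <-.
case: (revlex_total ne) => // /(revlex_in_last (esym d)) /(_ h1) h.
by rewrite h in h2.
Qed.

Lemma revlex_max (s : seq 'X_{1..n}) : s != [::] ->
  exists2 m, m \in s & forall m', m' \in s -> m' != m -> revlex_lt m' m.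
Proof.
elim: s => [//|a s IH] _; have [s0|/IH[m ms hm]] := eqVneq s [::].
  exists a; first exact: mem_head.
  by move=> m'; rewrite s0 inE => ->.
have [am|am] := eqVneq a m.
  exists m; first by rewrite inE ms orbT.
  by move=> m'; rewrite inE am => /orP[->//|]; exact: hm.
case: (revlex_total am) => lt_am.
  exists m; first by rewrite inE ms orbT.
  by move=> m'; rewrite inE => /orP[/eqP ->//|]; exact: hm.
exists a; first exact: mem_head.
move=> m'; rewrite inE => /orP[->//|m's] _.
have [->//|ne] := eqVneq m' m; exact: revlex_trans (hm _ m's ne) lt_am.
Qed.

(** There are finitely many monomials of a given degree; the measure is the number of smaller ones
    among those of degree at most e. *)
Lemma revlex_ind (e : nat) (P : 'X_{1..n} -> Prop) :
  (forall m, mdeg m = e ->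
    (forall m', mdeg m' = e -> revlex_lt m' m -> P m') -> P m) ->
  forall m, mdeg m = e -> P m.
Proof.
move=> IH; pose below m := [set b : 'X_{1..n < e.+1} | `[< revlex_lt b m >]]%SET.
suff h N m : (#|below m| < N)%N -> mdeg m = e -> P m.
  by move=> m; apply: (h #|below m|.+1).
elim: N m => [//|N IHN] m; rewrite ltnS => bN me; apply: IH => // m' m'e lt_m'.
apply: IHN => //; apply: leq_trans bN; apply: proper_card; apply/properP; split.
  apply/fintype.subsetP => b; rewrite !finset.in_set => h; apply: asboolT.
  exact: revlex_trans (asboolW h) lt_m'.
have bd : (mdeg m' < e.+1)%N by rewrite m'e.
exists (BMultinom bd); first by rewrite finset.in_set; exact: asboolT.
by rewrite finset.in_set; apply/negP => /asboolW; exact: revlex_irr.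
Qed.

End RevLex.

Section LeadMonomials.
Variables (k : fieldType) (n : nat).
Local Notation S := {mpoly k[n]}.
Implicit Types (f g : S) (m : 'X_{1..n}).

Definition restrict_supp (P : pred 'X_{1..n}) f : S :=
  \sum_(m <- msupp f | P m) f@_m *: 'X_[m].

Lemma mcoeff_restrict P f m : (restrict_supp P f)@_m = if P m then f@_m else 0.
Proof.
rewrite raddf_sum /= -big_filter.
under eq_bigr do rewrite mcoeffZ mcoeffX.
have [|nm] := boolP (m \in [seq m' <- msupp f | P m']).
  move=> mf; rewrite (bigD1_seq m) ?filter_uniq ?msupp_uniq //= eqxx mulr1.
  rewrite big1 => [|m' /negPf ->]; last by rewrite mulr0.
  by move: mf; rewrite mem_filter addr0 => /andP[-> _].
rewrite big_seq big1 => [|m' m'f]; last first.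
  by case: (m' =P m) => [E|]; [rewrite E (negPf nm) in m'f|rewrite mulr0].
move: nm; rewrite mem_filter negb_and; case: (P m) => //=.
by move=> /memN_msupp_eq0.
Qed.

Lemma restrict_supp_mem P f m : m \in msupp (restrict_supp P f) -> P m /\ m \in msupp f.
Proof. by rewrite !mcoeff_msupp mcoeff_restrict; case: (P m); rewrite ?eqxx. Qed.

Lemma restrict_suppN P f : mon_ideal P (f - restrict_supp (predC P) f).
Proof.
move=> m; rewrite mcoeff_msupp mcoeffB mcoeff_restrict /=.
by case: (P m); rewrite //= subrr eqxx.
Qed.

Lemma lead_exists f : f != 0 -> exists m, is_lead_monom f m.
Proof.
move=> f0; have [|m mf hm] := @revlex_max n (msupp f); last by exists m.
by rewrite msupp_eq0.
Qed.

Lemma homog_msupp e f m : f \is e.-homog -> m \in msupp f -> mdeg m = e.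
Proof. by move=> /dhomogP h /h. Qed.

Definition lead_of (I : set S) m : Prop := exists2 f, I f & is_lead_monom f m.

Lemma mcoeffXM (m0 : 'X_{1..n}) f m : ('X_[m0] * f)@_(m0 + m) = f@_m.
Proof. by rewrite mulrC mcoeffMX. Qed.

Lemma msuppXM (m0 : 'X_{1..n}) f m :
  m \in msupp ('X_[m0] * f) -> exists2 m', m' \in msupp f & m = (m0 + m')%MM.
Proof. by rewrite mulrC (perm_mem (msuppMX _ _)) => /mapP. Qed.

Lemma lead_ofD (I : set S) m m' : is_ideal I -> lead_of I m -> lead_of I (m' + m)%MM.
Proof.
move=> hI [f If [mf hm]]; exists ('X_[m'] * f); first exact: idealM.
split; first by rewrite mcoeff_msupp mcoeffXM -mcoeff_msupp.
move=> m1 /msuppXM[m2 m2f ->] ne; apply/revlex_add/hm => //.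
by apply: contra_neq ne => ->.
Qed.

(** Multiples of leading monomials are leading monomials, so membership in the initial ideal can be
    tested on each monomial separately. *)
Lemma initial_idealE (I : set S) : is_ideal I ->
  initial_ideal I = mon_ideal (fun m => `[< lead_of I m >]).
Proof.
move=> hI; apply/seteqP; split=> f.
  apply=> [|_ [m hm <-] m' /mem_msuppXP <-]; last exact/asboolP.
  by apply: mon_ideal_ideal => m m' /asboolP h; apply/asboolP/lead_ofD.
move=> hf J hJ sJ; rewrite [f]mpolyE; apply: (ideal_sum_closed hJ) => m /hf /asboolP h.
by apply: (idealZ _ hJ); apply: sJ; exists m.
Qed.

Lemma lead_of_homog (I : homogIdeal k n) m : lead_of (hideal_set I) m ->
  exists2 f, hideal_set I f /\ f \is (mdeg m).-homog & is_lead_monom f m.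
Proof.
move=> [f If [mf hm]]; exists (pihomog mdeg (mdeg m) f).
  by split; [exact: hideal_homog|exact: pihomogP].
have E m' : (pihomog mdeg (mdeg m) f)@_m' = if mdeg m' == mdeg m then f@_m' else 0.
  exact: (mcoeff_restrict (fun m' => mdeg m' == mdeg m)).
split; first by rewrite mcoeff_msupp E eqxx -mcoeff_msupp.
move=> m'; rewrite mcoeff_msupp E; case: ifP => // _; rewrite ?eqxx // -mcoeff_msupp.
exact: hm.
Qed.

Lemma lead_cancel e f g m : f \is e.-homog -> g \is e.-homog ->
  is_lead_monom f m -> is_lead_monom g m ->
  exists c : k, g - c *: f \is e.-homog /\
    forall m', m' \in msupp (g - c *: f) -> revlex_lt m' m.
Proof.
move=> hf hg [mf fm] [mg gm]; exists (g@_m / f@_m); split.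
  by apply: rpredB => //; exact: rpredZ.
move=> m' h; have ne : m' != m.
  apply: contraTneq h => ->; rewrite mcoeff_msupp mcoeffB mcoeffZ.
  by rewrite divfK ?subrr ?eqxx // -mcoeff_msupp.
have : m' \in msupp g ++ msupp f.
  rewrite mem_cat; apply: contraTT h; rewrite negb_or => /andP[h1 h2].
  by rewrite mcoeff_msupp mcoeffB mcoeffZ (memN_msupp_eq0 h1) (memN_msupp_eq0 h2) mulr0 subrr eqxx.
by rewrite mem_cat => /orP[/gm|/fm]; exact.
Qed.

(** Reduction: subtracting a multiple of an element of I with the same leading monomial lowers the
    leading monomial within its degree. *)
Lemma lead_of_sub (I I' : homogIdeal k n) :
  (forall f, hideal_set I f -> hideal_set I' f) ->
  (forall m, lead_of (hideal_set I') m -> lead_of (hideal_set I) m) ->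
  forall f, hideal_set I' f -> hideal_set I f.
Proof.
move=> sub sublead f I'f; rewrite [f]pihomog_sum.
apply: (ideal_sum_closed (hideal_ideal I)) => i _.
have := hideal_homog i I'f; have := pihomogP mdeg i f.
move: (pihomog mdeg i f) => {I'f}g; move: (nat_of_ord i) => e {i f} hg I'g.
have [->|g0] := eqVneq g 0; first exact: hideal0.
have [m gm] := lead_exists g0; have me : mdeg m = e := homog_msupp hg gm.1.
move: m me g hg I'g gm {g0}; apply: revlex_ind => m me IH g hg I'g gm.
have /lead_of_homog[f [If hf] fm] : lead_of (hideal_set I) m by apply: sublead; exists g.
rewrite me in hf; have [c [hh hlt]] := lead_cancel hf hg fm gm.
have Icf : hideal_set I (c *: f) by apply: (idealZ _ (hideal_ideal I)).
rewrite -[g](subrK (c *: f)); apply: (idealD (hideal_ideal I)) => //.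
have [->|h0] := eqVneq (g - c *: f) 0; first exact: hideal0.
have [m' hm'] := lead_exists h0.
apply: (IH m') => //; [exact: homog_msupp hh hm'.1|exact: hlt hm'.1|].
by apply: (idealB (hideal_ideal I')) => //; exact: sub.
Qed.

End LeadMonomials.

(** * Colons of an ideal and of its initial ideal *)

Section InitialColon.
Variables (k : fieldType) (n : nat).
Local Notation S := {mpoly k[n]}.
Local Notation x := (revX k n).
Local Notation Q j := (@mon_ideal k n (@in_last n j)).
Variable I : homogIdeal k n.
Local Notation hI := (hideal_ideal I).
Local Notation LM := (lead_of (hideal_set I)).
Local Notation J := (initial_ideal (hideal_set I)).

Lemma sum_last_ideal (K : set S) j : is_ideal K -> is_ideal (sum_last K j).
Proof.
move=> hK; have hQ := @last_ideal k n j; split.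
- by exists 0; [exact: (ideal0 hK)|rewrite subr0; exact: (ideal0 hQ)].
- move=> f g [a Ka ha] [b Kb hb]; exists (a + b); first exact: (idealD hK).
  by rewrite opprD addrACA; exact: (idealD hQ).
- move=> f g [a Ka ha]; exists (f * a); first exact: (idealM _ hK).
  by rewrite -mulrBr; exact: (idealM _ hQ).
Qed.

Lemma sum_last_l (K : set S) j f : K f -> sum_last K j f.
Proof. by move=> Kf; exists f; rewrite // subrr; apply: ideal0; exact: last_ideal. Qed.

Lemma sum_last_r (K : set S) j f : is_ideal K -> Q j f -> sum_last K j f.
Proof. by move=> hK Qf; exists 0; [exact: (ideal0 hK)|rewrite subr0]. Qed.

Lemma sum_last_initial j f : sum_last J j f <->
  forall m, m \in msupp f -> LM m \/ in_last j m.
Proof.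
rewrite (initial_idealE hI); split=> [[i Ji hq] m mf|h].
  have [mi|nmi] := boolP (m \in msupp i); first by left; apply: asboolW (Ji m mi).
  right; apply: hq; rewrite mcoeff_msupp mcoeffB (memN_msupp_eq0 nmi) subr0.
  by rewrite -mcoeff_msupp.
exists (restrict_supp (predC (@in_last n j)) f); last exact: restrict_suppN.
by move=> m /restrict_supp_mem[/= nm /h[|]]; [exact: asboolT|rewrite (negPf nm)].
Qed.

Lemma last_ideal_coeff j f m : Q j f -> ~~ in_last j m -> f@_m = 0.
Proof. by move=> hf nm; apply: memN_msupp_eq0; apply: contra nm; exact: hf. Qed.

(** Both sides are tested on monomials m outside Q_l. If x_l m is the leading monomial of f in I,
    the element of I obtained from f by cancelling x_l modulo Q_l has leading monomial m. *)
Lemma colon_initial (l : 'I_n) e : colon_at (hideal_set I) l e -> colon_at J l e.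
Proof.
move=> hc g hg /sum_last_initial hxg; apply/sum_last_initial => m mg.
have [|nm] := boolP (in_last l m); [by right|left].
pose i := rev_ord l.
have mdU (m' : 'X_{1..n}) : mdeg (U_(i) + m')%MM = (mdeg m').+1.
  by rewrite mdegD mdeg1.
have nUm : ~~ in_last l (U_(i) + m)%MM by rewrite in_lastU.
have hU : (U_(i) + m)%MM \in msupp (x l * g).
  by rewrite mcoeff_msupp revXE mcoeffXM -mcoeff_msupp.
have [/lead_of_homog[f [If hf] [mf fm]]|] := hxg _ hU; last by rewrite (negPf nUm).
have me : mdeg m = e := homog_msupp hg mg.
rewrite mdU me in hf.
have UQ : in_last l.+1 (U_(i) + m)%MM.
  by rewrite addmC; apply: in_lastDl; exact: in_last_leU.
(* Here the order matters: the leading monomial of f is divisible by x_l, so all of f lies in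
   Q_(l+1). *)
have Qf : Q l.+1 f.
  move=> m' m'f; have [-> //|ne] := eqVneq m' (U_(i) + m)%MM.
  apply: revlex_in_last (fm _ m'f ne) UQ.
  by rewrite (homog_msupp hf m'f) mdU me.
have [h|[b [g' [[eb] hg' hq]]]] := last_ideal_split_homog (ltn_ord l) Qf hf.
  by move: (h _ mf); rewrite (negPf nUm).
have xg' : sum_last (hideal_set I) l (x l * g').
  exists f => //; rewrite -opprB; exact: (idealN (@last_ideal k n l)).
rewrite -eb in hg'.
have [i' [Ii' hi'] hq'] := sum_last_homog_witness hg' (hc g' hg' xg').
(* Outside Q_l the element i' is f divided by x_l; its other monomials lie in Q_l and are smaller
   than m by [in_last_revlex]. *)
have coefE m' : ~~ in_last l m' -> i'@_m' = f@_(U_(i) + m').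
  move=> nm'; rewrite -[i'](subKr g') mcoeffB (last_ideal_coeff hq') // subr0.
  have := @last_ideal_coeff l _ (U_(i) + m')%MM hq.
  rewrite in_lastU => /(_ nm') /eqP; rewrite mcoeffB revXE mcoeffXM subr_eq0.
  by move=> /eqP.
exists i' => //; split; first by rewrite mcoeff_msupp coefE // -mcoeff_msupp.
move=> m' m'i ne; have [h|nm'] := boolP (in_last l m').
  by apply: in_last_revlex h nm; rewrite (homog_msupp hi' m'i) me.
apply/(revlex_add U_(i)%MM)/fm; first by rewrite mcoeff_msupp -coefE // -mcoeff_msupp.
by apply: contra_neq ne => /addmI.
Qed.

(** With g supported outside Q_l, an element of I congruent to x_l g has leading monomial x_l m; the
    colon condition for the initial ideal makes m a leading monomial of I, and g can be reduced. *)
Lemma sum_last_lead_reduce (l : 'I_n) e m : colon_at J l e -> mdeg m = e ->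
  forall g, g \is e.-homog -> is_lead_monom g m ->
  (forall m', m' \in msupp g -> ~~ in_last l m') ->
  sum_last (hideal_set I) l (x l * g) -> sum_last (hideal_set I) l g.
Proof.
move=> hc; move: m; apply: revlex_ind => m me IH g hg [mg gm] ng xg.
pose i := rev_ord l; have hS := @sum_last_ideal (hideal_set I) l hI.
have hxg : x l * g \is e.+1.-homog.
  by rewrite -add1n; apply: dhomogM => //; exact: revX_homog.
have mdU (m' : 'X_{1..n}) : mdeg (U_(i) + m')%MM = (mdeg m').+1.
  by rewrite mdegD mdeg1.
have LMU : LM (U_(i) + m)%MM.
  have [f [If hf] hq] := sum_last_homog_witness hxg xg.
  have coefE m' : ~~ in_last l m' -> f@_m' = (x l * g)@_m'.
    by move=> nm'; rewrite -[f](subKr (x l * g)) mcoeffB (last_ideal_coeff hq) // subr0.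
  have nUm : ~~ in_last l (U_(i) + m)%MM by rewrite in_lastU; exact: ng.
  exists f => //; split.
    by rewrite mcoeff_msupp coefE // revXE mcoeffXM -mcoeff_msupp.
  move=> m' m'f ne; have [h|nm'] := boolP (in_last l m').
    by apply: in_last_revlex h nUm; rewrite (homog_msupp hf m'f) mdU me.
  move: m'f; rewrite mcoeff_msupp coefE // -mcoeff_msupp revXE.
  move=> /msuppXM[m'' m''g m'E]; rewrite m'E in ne *; apply/revlex_add/gm => //.
  by apply: contra_neq ne => ->.
have /lead_of_homog[f [If hf] fm] : LM m.
  have : sum_last J l 'X_[m].
    apply: hc; first by rewrite dhomogX; apply/eqP.
    apply: sum_last_l; rewrite revXE -mpolyXD; apply: ideal_genS.
    by exists (U_(i) + m)%MM.
  by move=> /sum_last_initial /(_ m); rewrite msuppX mem_head (negPf (ng m mg)) => -[].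
rewrite me in hf; have [c [hh hlt]] := lead_cancel hf hg fm (conj mg gm).
have Icf : sum_last (hideal_set I) l (c *: f).
  by apply: sum_last_l; apply: (idealZ _ hI).
rewrite -[g](subrK (c *: f)); apply: (idealD hS) => //.
pose h := g - c *: f; rewrite -/h in hh hlt *.
(* Discarding the monomials in Q_l restores the support condition and only removes terms, so the
   leading monomial stays below m. *)
pose h1 := restrict_supp (predC (@in_last n l)) h.
have Qh : Q l (h - h1) by exact: restrict_suppN.
rewrite -[h](subrK h1); apply: (idealD hS); first exact: (sum_last_r hI).
have h1P m' : m' \in msupp h1 -> ~~ in_last l m' /\ m' \in msupp h.
  exact: restrict_supp_mem.
have [->|h10] := eqVneq h1 0; first exact: (ideal0 hS).
have [m' hm'] := lead_exists h10; have [_ m'h] := h1P m' hm'.1.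
apply: (IH m') => //.
- exact: homog_msupp hh m'h.
- exact: hlt.
- by apply/dhomogP => m'' /h1P[_ /(homog_msupp hh)].
- by move=> m'' /h1P[].
- rewrite -[h1](subKr h) mulrBr; apply: (idealB hS); last first.
    by apply: (sum_last_r hI); exact: (idealM _ (@last_ideal k n l)).
  rewrite mulrBr; apply: (idealB hS) => //; exact: (idealM _ hS).
Qed.

Lemma initial_colon (l : 'I_n) e : colon_at J l e -> colon_at (hideal_set I) l e.
Proof.
move=> hc g hg xg; have hS := @sum_last_ideal (hideal_set I) l hI.
pose g1 := restrict_supp (predC (@in_last n l)) g.
have Qg : Q l (g - g1) by exact: restrict_suppN.
rewrite -[g](subrK g1); apply: (idealD hS); first exact: (sum_last_r hI).
have [->|g10] := eqVneq g1 0; first exact: (ideal0 hS).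
have [m hm] := lead_exists g10.
have g1P m' : m' \in msupp g1 -> ~~ in_last l m' /\ m' \in msupp g.
  exact: restrict_supp_mem.
apply: (@sum_last_lead_reduce l e m) => //.
- by apply: homog_msupp hg _; have [] := g1P m hm.1.
- by apply/dhomogP => m' /g1P[_ /(homog_msupp hg)].
- by move=> m' /g1P[].
- rewrite -[g1](subKr g) mulrBr; apply: (idealB hS) => //.
  by apply: (sum_last_r hI); exact: (idealM _ (@last_ideal k n l)).
Qed.

Lemma initial_colonE (l : nat) e : (l < n)%N ->
  colon_at (hideal_set I) l e <-> colon_at J l e.
Proof.
move=> ln; split; [exact: (@colon_initial (Ordinal ln))|exact: (@initial_colon (Ordinal ln))].
Qed.

Lemma initial_eq0 :
  (forall f, hideal_set I f -> f = 0) <-> (forall f, J f -> f = 0).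
Proof.
split=> h f hf; apply: contrapT => /eqP f0; have [m hm] := lead_exists f0.
  move: hf; rewrite (initial_idealE hI) => /(_ m hm.1)/asboolW[g /h -> [+ _]].
  by rewrite msupp0.
have /h/eqP : J 'X_[m] by apply: ideal_genS; exists m => //; exists f.
by rewrite -msupp_eq0 msuppX.
Qed.

End InitialColon.

(** * Generic coordinates *)

Section Dickson.

(** Each index is chosen to minimise f on the tail after the previous one. *)
Lemma nondecreasing_subseq (f : nat -> nat) : exists s : nat -> nat,
  (forall i j, (i < j)%N -> (s i < s j)%N) /\
  (forall i j, (i <= j)%N -> (f (s i) <= f (s j))%N).
Proof.
have ex N : exists i, (N <= i)%N /\ forall j, (N <= j)%N -> (f i <= f j)%N.
  have ex : exists v, `[< exists i, (N <= i)%N /\ f i = v >].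
    by exists (f N); apply: asboolT; exists N.
  case: (ex_minnP ex) => v /asboolW[i [Ni iv]] vmin; exists i; split=> // j Nj.
  by rewrite iv; apply: vmin; apply: asboolT; exists j.
have [g hg] := choice ex.
pose s := fix s i := if i is j.+1 then g (s j).+1 else g 0%N.
have sS i : (s i < s i.+1)%N by have [] := hg (s i).+1.
have smono i j : (i < j)%N -> (s i < s j)%N.
  elim: j => // j IH; rewrite ltnS leq_eqVlt => /orP[/eqP -> //|/IH h].
  exact: ltn_trans h (sS j).
exists s; split=> // i j; rewrite leq_eqVlt => /orP[/eqP -> //|ij].
case: i ij => [|i] ij; first by have [_ ->] := hg 0%N.
have [_ ->] // := hg (s i).+1.
by apply: smono; exact: ltnW.
Qed.

Lemma dickson n (u : nat -> 'X_{1..n}) : exists i j, (i < j)%N /\ (u i <= u j)%MM.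
Proof.
have sub r : (r <= n)%N -> exists s : nat -> nat,
    (forall i j, (i < j)%N -> (s i < s j)%N) /\
    (forall i j, (i <= j)%N -> forall l : 'I_n, (l < r)%N -> (u (s i) l <= u (s j) l)%N).
  elim: r => [_|r IH rn]; first by exists id.
  have [s [smono hs]] := IH (ltnW rn).
  have [t [tmono ht]] := nondecreasing_subseq (fun i => u (s i) (Ordinal rn)).
  exists (s \o t); split=> [i j ij|i j ij l].
    by apply: smono; exact: tmono.
  rewrite ltnS leq_eqVlt => /orP[/eqP lr|lr] /=.
    by rewrite (_ : l = Ordinal rn); [exact: ht|exact: val_inj].
  apply: hs => //; move: ij; rewrite leq_eqVlt => /orP[/eqP -> //|ij].
  by apply: ltnW; exact: tmono.
have [s [smono hs]] := sub n (leqnn n).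
exists (s 0%N), (s 1%N); split; first exact: smono.
by apply/mnm_lepP => l; apply: hs.
Qed.

End Dickson.

(** * Noetherian induction and avoidance of subspaces *)

Section Noetherian.
Variables (k : fieldType) (n : nat).
Local Notation S := {mpoly k[n]}.

(** Each step of a strictly increasing chain gains a leading monomial by [lead_of_sub]. By Dickson's
    lemma some gained monomial divides a later one, which therefore was not new. *)
Lemma noetherian_ind (P : homogIdeal k n -> Prop) :
  (forall I : homogIdeal k n, (forall I' : homogIdeal k n,
      (forall f, hideal_set I f -> hideal_set I' f) ->
      (exists2 f, hideal_set I' f & ~ hideal_set I f) -> P I') -> P I) ->
  forall I, P I.
Proof.
move=> step I0; apply: contrapT => nP0.
have next (I : {I : homogIdeal k n | ~ P I}) : exists I' : {I : homogIdeal k n | ~ P I},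
    (forall f, hideal_set (sval I) f -> hideal_set (sval I') f) /\
    exists2 f, hideal_set (sval I') f & ~ hideal_set (sval I) f.
  apply: contrapT => h; case: (svalP I); apply: step => I' sub ex.
  by apply: contrapT => nP; apply: h; exists (exist _ I' nP).
have [nxt hnxt] := choice next.
pose c := fix c i := if i is j.+1 then nxt (c j) else exist _ I0 nP0.
have mono i j f : (i <= j)%N -> hideal_set (sval (c i)) f -> hideal_set (sval (c j)) f.
  elim: j => [|j IH]; first by rewrite leqn0 => /eqP ->.
  rewrite leq_eqVlt => /orP[/eqP -> //|ij] /(IH ij).
  by have [+ _] := hnxt (c j); exact.
have lead i : exists m, lead_of (hideal_set (sval (c i.+1))) m /\
    ~ lead_of (hideal_set (sval (c i))) m.
  have [sub [f hf nf]] := hnxt (c i); apply: contrapT => h; apply: nf.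
  apply: lead_of_sub sub _ f hf => m hm; apply: contrapT => nm.
  by apply: h; exists m.
have [u hu] := choice lead.
have [i [j [ij le_u]]] := dickson u.
have [_] := hu j; apply; rewrite -(submK le_u); apply: lead_ofD.
  exact: hideal_ideal.
by have [[f hf fm] _] := hu i; exists f => //; exact: mono hf.
Qed.

Definition lin (v : 'cV[k]_n) : S := \sum_i v i 0 *: 'X_i.

Lemma lin_homog v : lin v \is 1.-homog.
Proof.
apply: rpred_sum => i _; apply: rpredZ.
by rewrite dhomogX; apply/eqP/mdeg1.
Qed.

Lemma linP c u v : lin (c *: u + v) = c *: lin u + lin v.
Proof.
rewrite /lin scaler_sumr -big_split; apply: eq_bigr => i _.
by rewrite !mxE scalerDl scalerA.
Qed.

Lemma lin_delta i : lin (delta_mx i 0) = 'X_i.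
Proof.
rewrite /lin (bigD1 i) //= mxE !eqxx scale1r big1 ?addr0 // => j /negPf ne.
by rewrite mxE ne scale0r.
Qed.

Definition subspace (V : set 'cV[k]_n) : Prop :=
  forall c u v, V u -> V v -> V (c *: u + v).

Definition proper_subspace (V : set 'cV[k]_n) : Prop :=
  subspace V /\ exists v, ~ V v.

Definition filter_regular (I : set S) (z : S) : Prop :=
  exists D : nat, forall e, (D < e)%N -> forall g, g \is e.-homog -> I (z * g) -> I g.

Fact colon_ideal (I : set S) a : is_ideal I -> is_ideal [set f | I (a * f)].
Proof.
move=> hI; split=> /= [|f g hf hg|f g hg].
- by rewrite mulr0; exact: ideal0.
- by rewrite mulrDr; exact: idealD.
- by rewrite mulrCA; exact: idealM.
Qed.

Fact colon_homog (I : homogIdeal k n) d a (e : nat) f : a \is d.-homog ->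
  hideal_set I (a * f) -> hideal_set I (a * pihomog mdeg e f).
Proof.
move=> ha /(hideal_homog (d + e)%N).
by rewrite (pihomogMl _ _ ha) leq_addr addKn.
Qed.

Definition colon_by (I : homogIdeal k n) d a (ha : a \is d.-homog) : homogIdeal k n :=
  HomogIdeal (colon_ideal a (hideal_ideal I)) (fun e f => @colon_homog I d a e f ha).

Lemma add_elt_sub (I : homogIdeal k n) d a (ha : a \is d.-homog) f :
  hideal_set I f -> hideal_set (add_elt I ha) f.
Proof. by move=> If; exists 0; rewrite mulr0 subr0. Qed.

Lemma homog_pos_mem (I : homogIdeal k n) e g : (forall i, hideal_set I 'X_i) ->
  (0 < e)%N -> g \is e.-homog -> hideal_set I g.
Proof.
move=> hX e0 /dhomogP hg; have hI := hideal_ideal I.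
rewrite [g]mpolyE; apply: (ideal_sum_closed hI) => m /hg /= me; apply: (idealZ _ hI).
have [|m' le_m' /eqP] := @exists_submonomial n m 1; first by rewrite me.
rewrite mdeg_eq1 => /existsP[i /eqP m'E].
by rewrite -(submK le_m') mpolyXD m'E; exact: (idealM _ hI).
Qed.

(* Noetherian induction through 0 -> S/(I:a) -> S/I -> S/(I+a) -> 0 reduces *)
(* to the case of a prime ideal, in place of associated primes. *)
Lemma bad_linear_forms (I : homogIdeal k n) : exists Vs : seq (set 'cV[k]_n),
  (forall V, V \in Vs -> proper_subspace V) /\
  forall v, (forall V, V \in Vs -> ~ V v) -> filter_regular (hideal_set I) (lin v).
Proof.
elim/noetherian_ind: I => I IH; have hI := hideal_ideal I.
have [[d [a [d' [b [ha [hb [nIa [nIb Iab]]]]]]]]|prime] := pselect (exists d a d' b,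
    a \is d.-homog /\ b \is d'.-homog /\ ~ hideal_set I a /\ ~ hideal_set I b /\
    hideal_set I (a * b)).
  have [||Vs1 [V1 reg1]] := IH (add_elt I ha).
  - exact: add_elt_sub.
  - by exists a => //; exists 1; rewrite mulr1 subrr; exact: hideal0.
  have [||Vs2 [V2 reg2]] := IH (colon_by I ha).
  - by move=> f If; exact: (idealM _ hI).
  - by exists b.
  exists (Vs1 ++ Vs2); split=> [V|v hv].
    by rewrite mem_cat => /orP[/V1|/V2].
  have [|D1 hD1] := reg1 v; first by move=> V h; apply: hv; rewrite mem_cat h.
  have [|D2 hD2] := reg2 v; first by move=> V h; apply: hv; rewrite mem_cat h orbT.
  (* D1 brings g into I + (a); the cofactor s of a has degree e - d, which has to exceed D2. *)
  exists (D1 + (d + D2))%N => e De g hg Izg.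
  have e1 : (D1 < e)%N by apply: leq_ltn_trans De; exact: leq_addr.
  have := hD1 e e1 g hg (add_elt_sub ha Izg).
  move=> /(add_elt_homog_witness ha hg)[//|[s [le_de hs] Igs]].
  suff Ias : hideal_set I (a * s) by rewrite -[g](subrK (a * s)); exact: (idealD hI).
  apply: (hD2 (e - d)%N) => //=.
    by rewrite ltn_subRL; apply: leq_ltn_trans De; exact: leq_addl.
  have -> : a * (lin v * s) = lin v * g - lin v * (g - a * s) by ring.
  by apply: (idealB hI) => //; exact: (idealM _ hI).
(* I now satisfies the prime condition on homogeneous elements, so any linear form outside I is a
   nonzerodivisor modulo I. If none lies outside, I contains everything of positive degree. *)
have [[v0 nv0]|h] := pselect (exists v, ~ hideal_set I (lin v)).
  exists [:: [set v | hideal_set I (lin v)]]; split=> [V|v hv].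
    rewrite inE => /eqP ->; split; last by exists v0.
    by move=> c u w hu hw; rewrite /= linP; apply: (idealD hI) => //; exact: (idealZ _ hI).
  have nv : ~ hideal_set I (lin v) by apply: (hv _ (mem_head _ _)).
  exists 0%N => e _ g hg Izg; apply: contrapT => nIg; apply: prime.
  by exists 1%N, (lin v), e, g; split; [exact: lin_homog|].
exists [::]; split=> // v _; exists 0%N => e e0 g hg _.
apply: homog_pos_mem hg => // i; rewrite -lin_delta; apply: contrapT => nX.
by apply: h; exists (delta_mx i 0).
Qed.

Hypothesis k_infinite : forall s : seq k, exists x : k, x \notin s.

(** A line whose direction v is not in V meets V in at most one point. *)
Lemma line_avoid (Vs : seq (set 'cV[k]_n)) u v :
  (forall V, V \in Vs -> subspace V) -> (forall V, V \in Vs -> ~ V v) ->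
  exists s : seq k, forall c, c \notin s -> forall V, V \in Vs -> ~ V (u + c *: v).
Proof.
elim: Vs => [|V Vs IH] sub nv; first by exists [::].
have [||s hs] := IH.
- by move=> W WVs; apply: sub; rewrite inE WVs orbT.
- by move=> W WVs; apply: nv; rewrite inE WVs orbT.
have subV := sub V (mem_head _ _); have nVv := nv V (mem_head _ _).
have [[c0 hc0]|nc] := pselect (exists c, V (u + c *: v)); last first.
  exists s => c cs W; rewrite inE => /orP[/eqP ->|]; last exact: hs.
  by move=> h; apply: nc; exists c.
exists (c0 :: s) => c; rewrite inE negb_or => /andP[ne cs] W.
rewrite inE => /orP[/eqP ->|]; last exact: hs.
move=> hc; apply: nVv.
have h1 : V ((c - c0) *: v).
  have := subV (-1) _ _ hc0 hc; congr V.
  by rewrite scaleN1r opprD addrACA addNr add0r scalerBl addrC.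
have V0 : V 0 by have := subV (-1) _ _ h1 h1; rewrite scaleN1r addNr.
have := subV (c - c0)^-1 _ _ h1 V0; rewrite addr0 scalerA mulVf ?scale1r //.
by rewrite subr_eq0.
Qed.

Lemma subspaces_avoid (Vs : seq (set 'cV[k]_n)) :
  (forall V, V \in Vs -> proper_subspace V) -> exists v, forall V, V \in Vs -> ~ V v.
Proof.
elim: Vs => [|V Vs IH] prop; first by exists 0.
have propVs W : W \in Vs -> proper_subspace W.
  by move=> h; apply: prop; rewrite inE h orbT.
have [v hv] := IH propVs.
have [subV [u nu]] := prop V (mem_head _ _).
have [Vv|nVv] := pselect (V v); last first.
  by exists v => W; rewrite inE => /orP[/eqP ->|]; last exact: hv.
have [s hs] := @line_avoid Vs u v (fun W h => (propVs W h).1) hv.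
have [c cs] := k_infinite s.
exists (u + c *: v) => W; rewrite inE => /orP[/eqP ->|]; last exact: hs.
move=> h; apply: nu.
by have := subV (- c) _ _ Vv h; rewrite scaleNr addrC addrK.
Qed.

Lemma exists_many (s : seq k) N : exists r : seq k,
  [/\ uniq r, size r = N & forall c, c \in r -> c \notin s].
Proof.
elim: N => [|N [r [ur sr hr]]]; first by exists [::].
have [c] := k_infinite (r ++ s); rewrite mem_cat negb_or => /andP[cr cs].
exists (c :: r); split=> //=; [by rewrite cr|by rewrite sr|].
by move=> c'; rewrite inE => /orP[/eqP ->|/hr].
Qed.

Lemma poly_avoid (p : {poly k}) (s : seq k) : p != 0 ->
  exists2 c, c \notin s & p.[c] != 0.
Proof.
move=> p0; have [r [ur sr hr]] := exists_many s (size p).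
apply: contrapT => h; suff rp : all (root p) r.
  by have := max_poly_roots p0 rp ur; rewrite sr ltnn.
apply/allP => c cr; apply/rootP; apply: contrapT => /eqP pc; apply: h.
by exists c; [exact: hr|].
Qed.

End Noetherian.

Section CoordinateChange.
Variables (k : fieldType) (n : nat).
Local Notation S := {mpoly k[n]}.

Definition gl_mor (g : 'M[k]_n) : {lrmorphism S -> S} :=
  comp_mpoly [tuple \sum_(i < n) g i j *: 'X_i | j < n].

Lemma gl_morE g f : gl_mor g f = gl_act g f.
Proof. by []. Qed.

Lemma gl_morM g f1 f2 : gl_mor g (f1 * f2) = gl_mor g f1 * gl_mor g f2.
Proof. exact: rmorphM. Qed.

Lemma gl_morB g f1 f2 : gl_mor g (f1 - f2) = gl_mor g f1 - gl_mor g f2.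
Proof. exact: raddfB. Qed.

Lemma gl_morX g (j : 'I_n) : gl_mor g 'X_j = lin (col j g).
Proof.
rewrite /gl_mor /= comp_mpolyXU -tnth_nth tnth_mktuple /lin.
by apply: eq_bigr => i _; rewrite mxE.
Qed.

Lemma lrmorphism_ext (f g : {lrmorphism S -> S}) :
  (forall i, f 'X_i = g 'X_i) -> f =1 g.
Proof.
move=> fg p; rewrite [p]mpolyE !raddf_sum; apply: eq_bigr => m _.
have fgX : f 'X_[m] = g 'X_[m].
  rewrite mpolyXE_id !rmorph_prod; apply: eq_bigr => i _.
  by rewrite !rmorphXn /= fg.
transitivity (p@_m *: f 'X_[m]); first exact: linearZ.
by rewrite fgX; apply/esym; exact: linearZ.
Qed.

Lemma gl_mor_lin g v : gl_mor g (lin v) = lin (g *m v).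
Proof.
rewrite /lin raddf_sum /=.
under eq_bigr do rewrite linearZ /= gl_morX /lin scaler_sumr.
rewrite exchange_big /=; apply: eq_bigr => i _.
rewrite !mxE scaler_suml; apply: eq_bigr => j _.
by rewrite mxE scalerA mulrC.
Qed.

Lemma col_delta (g : 'M[k]_n) j : g *m delta_mx j 0 = col j g.
Proof. by rewrite colE. Qed.

Lemma gl_mor_comp g h f : gl_mor g (gl_mor h f) = gl_mor (g *m h) f.
Proof.
have E := @lrmorphism_ext (gl_mor g \o gl_mor h : {lrmorphism S -> S}) (gl_mor (g *m h)).
apply: (E _ f) => i.
rewrite [LHS](_ : _ = gl_mor g (gl_mor h 'X_i)) //.
by rewrite !gl_morX gl_mor_lin -!col_delta mulmxA.
Qed.

Lemma gl_mor1 f : gl_mor 1%:M f = f.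
Proof.
have E := @lrmorphism_ext (gl_mor 1%:M) (idfun : {lrmorphism S -> S}).
by apply: (E _ f) => i; rewrite gl_morX -col_delta mul1mx lin_delta.
Qed.

Lemma gl_morK g : g \in unitmx -> cancel (gl_mor g) (gl_mor (invmx g)).
Proof. by move=> ug f; rewrite gl_mor_comp mulVmx // gl_mor1. Qed.

Lemma gl_morVK g : g \in unitmx -> cancel (gl_mor (invmx g)) (gl_mor g).
Proof. by move=> ug f; rewrite gl_mor_comp mulmxV // gl_mor1. Qed.

Lemma gl_mor_homog g d f : f \is d.-homog -> gl_mor g f \is d.-homog.
Proof.
move=> /dhomogP hf; rewrite [f]mpolyE raddf_sum /= big_seq.
apply: rpred_sum => m /hf /= <-; rewrite linearZ; apply: rpredZ.
rewrite mpolyXE_id rmorph_prod mdegE.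
elim/big_rec2: _ => [|i e p _ hp]; first exact: dhomog1.
apply: dhomogM => //; rewrite rmorphXn /= gl_morX.
by have := dhomogMn (m i) (lin_homog (col i g)); rewrite mul1n.
Qed.

Section ImageIdeal.
Variables (I : homogIdeal k n) (g : 'M[k]_n).
Hypothesis ug : g \in unitmx.

Fact gl_image_ideal : is_ideal [set gl_act g f | f in hideal_set I].
Proof.
have hI := hideal_ideal I; split.
- by exists 0; [exact: hideal0|exact: (raddf0 (gl_mor g))].
- move=> _ _ [a Ia <-] [b Ib <-]; exists (a + b); first exact: (idealD hI).
  exact: (raddfD (gl_mor g)).
- move=> f _ [b Ib <-]; exists (gl_mor (invmx g) f * b); first exact: (idealM _ hI).
  by rewrite -!gl_morE gl_morM gl_morVK.
Qed.

Fact gl_image_homog d f : [set gl_act g f | f in hideal_set I] f ->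
  [set gl_act g f | f in hideal_set I] (pihomog mdeg d f).
Proof.
move=> [a Ia <-]; exists (pihomog mdeg d a); first exact: hideal_homog.
by rewrite -!gl_morE phi_pihomog //; exact: gl_mor_homog.
Qed.

Definition gl_image : homogIdeal k n := HomogIdeal gl_image_ideal gl_image_homog.

Lemma gl_imageP f : hideal_set I f <-> hideal_set gl_image (gl_mor g f).
Proof.
split=> [If|[a Ia /(can_inj (gl_morK ug)) <- //]]; by exists f.
Qed.

End ImageIdeal.

End CoordinateChange.

(** * Generic choice of the linear forms *)

Section GenericChoice.
Variables (k : fieldType) (n : nat).
Local Notation S := {mpoly k[n]}.
Hypothesis k_infinite : forall s : seq k, exists x : k, x \notin s.
Variable I : homogIdeal k n.

Fixpoint lin_chain (w : nat -> 'cV[k]_n) (l : nat) : homogIdeal k n :=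
  if l is l'.+1 then add_elt (lin_chain w l') (lin_homog (w l')) else I.

Lemma lin_chain_ext w w' l : (forall i, (i < l)%N -> w i = w' i) ->
  lin_chain w l = lin_chain w' l.
Proof.
elim: l => [//|l IH] h /=; rewrite IH; last by move=> i il; apply/h/ltnW.
by rewrite h.
Qed.

Definition revcol (h : 'M[k]_n) (l : nat) : 'cV[k]_n :=
  if insub l is Some i then col (@rev_ord n i) h else 0.

Lemma revcolE h (l : 'I_n) : revcol h l = col (rev_ord l) h.
Proof. by rewrite /revcol valK. Qed.

Variables (p : {mpoly k[n * n]}) (s0 : k).

(** Up to a scalar h is the inverse of g = s0 adj h: its columns are the linear forms that g sends
    to multiples of the variables, while p restricts g. The adjugate keeps the condition polynomial
    in h. *)
Definition generic_point (h : 'M[k]_n) : Prop :=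
  \det h != 0 /\ p.@[fun i => mxvec (s0 *: \adj h) 0 i] != 0.

(** The line moves only column j. Along it the two conditions have as product a polynomial in c that
    is nonzero at c = 0, so it has finitely many roots. *)
Lemma generic_line (h : 'M[k]_n) (j : 'I_n) (v : 'cV[k]_n) (s : seq k) :
  generic_point h -> exists2 c, c \notin s &
    generic_point (h + c *: (v *m delta_mx 0 j)).
Proof.
move=> [dh ph].
pose H : 'M[{poly k}]_n :=
  map_mx polyC h + 'X *: map_mx polyC (v *m delta_mx 0 j).
pose P := mmap (@polyC k) (fun i => mxvec (s0%:P *: \adj H) 0 i) p.
have HE c : map_mx (horner_eval c) H = h + c *: (v *m delta_mx 0 j).
  apply/matrixP => a b.
  by rewrite !mxE /horner_eval hornerD hornerM !hornerC hornerX.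
have PE c : P.[c] = p.@[fun i => mxvec (s0 *: \adj (h + c *: (v *m delta_mx 0 j))) 0 i].
  rewrite /P /meval /mmap horner_sum; apply: eq_bigr => m _.
  rewrite hornerM hornerC; congr (_ * _).
  rewrite /mmap1 horner_prod; apply: eq_bigr => i _.
  rewrite horner_exp; congr (_ ^+ _).
  rewrite -HE -map_mx_adj; case/mxvec_indexP: i => a b; rewrite !mxvecE !mxE.
  by rewrite /horner_eval hornerM hornerC.
have dE c : (\det H).[c] = \det (h + c *: (v *m delta_mx 0 j)).
  by rewrite -HE det_map_mx.
have PH0 : P * \det H != 0.
  apply: contra_neq ph => /(congr1 (fun q => q.[0])).
  rewrite hornerM PE dE scale0r addr0 horner0 => /eqP.
  by rewrite mulf_eq0 (negPf dh) orbF => /eqP.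
have [c cs] := poly_avoid k_infinite s PH0.
rewrite hornerM PE dE mulf_eq0 negb_or => /andP[h1 h2].
by exists c.
Qed.

Lemma generic_column (h : 'M[k]_n) (j : 'I_n) (Vs : seq (set 'cV[k]_n)) :
  generic_point h -> (forall V, V \in Vs -> proper_subspace V) ->
  exists h', [/\ generic_point h', forall i, i != j -> col i h' = col i h
    & forall V, V \in Vs -> ~ V (col j h')].
Proof.
move=> gh hV; have [v hv] := subspaces_avoid k_infinite hV.
have [s hs] := @line_avoid k n Vs (col j h) v (fun V VVs => (hV V VVs).1) hv.
have [c cs gc] := generic_line j v s gh.
have E i : col i (h + c *: (v *m delta_mx 0 j)) = col i h + (if i == j then c *: v else 0).
  apply/matrixP => a b; rewrite !mxE big_ord1 !mxE eqxx /=.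
  by case: eqP => _; rewrite ?mulr1 ?mulr0 ?mxE ?(ord1 b).
exists (h + c *: (v *m delta_mx 0 j)); split=> // [i /negPf ij|V VVs].
  by rewrite E ij addr0.
by rewrite E eqxx; exact: hs.
Qed.

(** Columns are corrected one at a time from the last. The subspaces to be avoided by a column
    depend only on those already fixed, which later corrections do not touch. *)
Lemma generic_chain (h0 : 'M[k]_n) : generic_point h0 -> exists2 h, generic_point h &
  forall l, (l < n)%N ->
    filter_regular (hideal_set (lin_chain (revcol h) l)) (lin (revcol h l)).
Proof.
move=> g0.
have sub r : (r <= n)%N -> exists2 h, generic_point h & forall l, (l < r)%N ->
    filter_regular (hideal_set (lin_chain (revcol h) l)) (lin (revcol h l)).
  elim: r => [_|r IH rn]; first by exists h0.
  have [h gh hh] := IH (ltnW rn).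
  have [Vs [hV reg]] := bad_linear_forms (lin_chain (revcol h) r).
  pose j := rev_ord (Ordinal rn).
  have [h' [gh' colE hj]] := generic_column j gh hV.
  have same l : (l < r)%N -> revcol h' l = revcol h l.
    move=> lr; have ln := ltn_trans lr rn.
    rewrite -[l]/(nat_of_ord (Ordinal ln)) !revcolE; apply: colE.
    by rewrite (inj_eq rev_ord_inj) -val_eqE /= neq_ltn lr.
  exists h' => // l; rewrite ltnS leq_eqVlt => /orP[/eqP ->|lr].
    rewrite (lin_chain_ext same); apply: reg => V /hj.
    by rewrite -[r]/(nat_of_ord (Ordinal rn)) revcolE.
  rewrite same // (lin_chain_ext (w' := revcol h)); first exact: hh.
  by move=> i il; apply: same; exact: ltn_trans il lr.
by have [h gh hh] := sub n (leqnn n); exists h.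
Qed.

End GenericChoice.

Section GenericFilterRegular.
Variables (k : fieldType) (n : nat).
Local Notation S := {mpoly k[n]}.
Local Notation x := (revX k n).
Hypothesis k_infinite : forall s : seq k, exists x : k, x \notin s.
Variable I : homogIdeal k n.

(** As g h is scalar, g maps the l-th chosen form to c x_l, and so I plus the first l forms to gI +
    Q_l. *)
Lemma lin_chain_image (g h : 'M[k]_n) (ug : g \in unitmx) c : c != 0 ->
  g *m h = c%:M -> forall l, (l <= n)%N -> forall f,
  hideal_set (lin_chain I (revcol h) l) f <->
  sum_last (hideal_set (gl_image I ug)) l (gl_mor g f).
Proof.
move=> c0 gh.
have linE l : (l < n)%N -> gl_mor g (lin (revcol h l)) = c *: x l.
  move=> ln; rewrite -[l]/(nat_of_ord (Ordinal ln)) revcolE revXE gl_mor_lin.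
  rewrite -col_delta mulmxA gh mul_scalar_mx -lin_delta /lin scaler_sumr.
  by apply: eq_bigr => i _; rewrite [in LHS]mxE scalerA.
have hK := hideal_ideal (gl_image I ug).
elim=> [|l IH] ln f.
  rewrite /= (gl_imageP I ug); split=> [h1|[i Ii /last_ideal0 /eqP]].
    exact: sum_last_l h1.
  by rewrite subr_eq0 => /eqP E; rewrite -E in Ii.
have {}IH := IH (ltnW ln).
have mul s : gl_mor g (f - lin (revcol h l) * s) = gl_mor g f - x l * (c *: gl_mor g s).
  by rewrite gl_morB gl_morM linE // -scalerAl scalerAr.
split=> [[s /IH]|[i Ii hq]].
  rewrite mul => -[i Ii hq]; exists i => //.
  rewrite -[_ - i](subrK (x l * (c *: gl_mor g s))).
  apply: (idealD (@last_ideal k n _)).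
    by apply: last_idealS => //; rewrite addrAC.
  by rewrite mulrC; apply: (idealM _ (@last_ideal k n _)); exact: last_idealX.
have [t ht] := last_ideal_split ln hq.
exists (gl_mor (invmx g) (c^-1 *: t)); apply/IH; rewrite mul gl_morVK //.
by rewrite scalerA mulfV // scale1r; exists i; rewrite // addrAC.
Qed.

Lemma generic_colon (U : set 'M[k]_n) : GL_zariski_open U -> U !=set0 ->
  exists g (ug : g \in unitmx), U g /\
    exists D : nat, forall l, (l < n)%N -> forall e, (D < e)%N ->
      colon_at (hideal_set (gl_image I ug)) l e.
Proof.
move=> [F ->] [g0 [ug0 [p Fp pg0]]].
pose s0 := \det g0.
have s00 : s0 != 0 by rewrite -unitfE -unitmxE.
have gen0 : generic_point p s0 (invmx g0).
  split; first by rewrite det_inv invr_eq0.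
  (* The adjugate of the inverse of g0 is g0 divided by its determinant; this fixes the choice of s0
     and makes g0 itself the starting point. *)
  have -> : s0 *: \adj (invmx g0) = g0; last by [].
  have := invmxK g0; rewrite {1}/invmx unitmx_inv ug0 det_inv invrK => E.
  exact: E.
have [h [dh ph] hh] := generic_chain k_infinite I gen0.
pose g := s0 *: \adj h; pose c := s0 * \det h.
have c0 : c != 0 by rewrite mulf_neq0.
have gh : g *m h = c%:M by rewrite -scalemxAl mul_adj_mx scale_scalar_mx.
have ug : g \in unitmx.
  have : \det (g *m h) != 0 by rewrite gh det_scalar expf_neq0.
  by rewrite det_mulmx mulf_eq0 negb_or unitmxE unitfE => /andP[].
exists g, ug; split; first by split=> //; exists p.
have /choice[D hD] : forall l, exists D : nat, (l < n)%N ->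
    forall e, (D < e)%N -> forall f, f \is e.-homog ->
    hideal_set (lin_chain I (revcol h) l) (lin (revcol h l) * f) ->
    hideal_set (lin_chain I (revcol h) l) f.
  move=> l; have [ln|nl] := boolP (l < n)%N; last by exists 0%N.
  by have [D hD] := hh l ln; exists D.
exists (\max_(l < n) D l)%N => l ln e De f hf xf.
have Dl : (D l < e)%N.
  by apply: leq_ltn_trans De; exact: (leq_bigmax (Ordinal ln)).
have chainP := lin_chain_image ug c0 gh (ltnW ln).
have := hD l ln e Dl (gl_mor (invmx g) f) (gl_mor_homog _ hf).
rewrite !chainP gl_morM gl_morVK //; apply.
rewrite -[l in lin (revcol h l)]/(nat_of_ord (Ordinal ln)) revcolE gl_mor_lin.
rewrite -col_delta mulmxA gh mul_scalar_mx.
have -> : lin (c *: delta_mx (rev_ord (Ordinal ln)) 0) = c *: x l.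
  rewrite -[c *: _]addr0 linP lin_delta -[l in x l]/(nat_of_ord (Ordinal ln)) revXE.
  by rewrite /lin big1 ?addr0 // => i _; rewrite mxE scale0r.
rewrite -scalerAl; apply: idealZ => //; apply: sum_last_ideal; exact: hideal_ideal.
Qed.

End GenericFilterRegular.

(** * Invariants *)

Section Invariants.
Local Open Scope ereal_scope.

(** The default +oo is consistent: a nonempty set of integers without largest element is not bounded
    above. *)
Lemma max_int_le (A : set int) (c : int) :
  max_int A <= c%:E <-> forall d, A d -> (d <= c)%R.
Proof.
rewrite /max_int; case: pselect => [H|nmax].
  case: (cid H) => m [Am hm] /=; rewrite lee_fin; split=> [mc d Ad|]; last exact.
  exact: le_trans (hm d Ad) mc.
have [->|A0] := eqVneq A set0; first by rewrite leNye.
split=> // hc; case: nmax; have /set0P[a Aa] := A0.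
have ex : exists v : nat, `[< exists2 d, A d & (c - d)%R = v%:Z >].
  exists `|c - a|%N; apply: asboolT; exists a => //.
  by rewrite gez0_abs // subr_ge0 hc.
case: (ex_minnP ex) => v /asboolW[m Am mv] vmin; exists m; split=> // d Ad.
have h : (v <= `|(c - d)%R|)%N.
  apply: vmin; apply: asboolT; exists d => //.
  by rewrite gez0_abs // subr_ge0 hc.
by have := hc d Ad; lia.
Qed.

(** Since the integers have neither a least nor a greatest element, integer upper bounds also tell
    both infinities from finite values. *)
Lemma ereal_int_eq (x y : \bar int) :
  (forall c : int, x <= c%:E <-> y <= c%:E) -> x = y.
Proof.
case: x y => [r| |] [s| |] h //.
- by congr _%:E; apply/eqP; rewrite eq_le -!lee_fin; apply/andP; split; apply/h.
- by have := proj1 (h r) (lexx _); rewrite leye_eq.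
- by have := proj2 (h (r - 1)%R) (leNye _); rewrite lee_fin; lia.
- by have := proj2 (h s) (lexx _); rewrite leye_eq.
- by have := proj2 (h 0%R) (leNye _); rewrite leye_eq.
- by have := proj1 (h (s - 1)%R) (leNye _); rewrite lee_fin; lia.
- by have := proj1 (h 0%R) (leNye _); rewrite leye_eq.
Qed.

Variables (k : fieldType) (n : nat).

Definition vanishes_beyond (M : gradedModule k n) (c : nat -> int) t : Prop :=
  forall i, (i <= t)%N -> forall d : int, (c i < d)%R -> ~ lc_neq0 M i d.

Lemma bigmaxe_le (F : nat -> \bar int) t (c : int) :
  \big[maxe/-oo]_(i < t.+1) F i <= c%:E <-> forall i, (i <= t)%N -> F i <= c%:E.
Proof.
split=> [/bigmax_leP[_ h] i it|h].
  exact: (h (Ordinal (it : (i < t.+1)%N))).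
by apply/bigmax_leP; split=> [|i _]; [exact: leNye|apply: h; rewrite -ltnS].
Qed.

Lemma a_star_le (M : gradedModule k n) t c :
  a_star M t <= c%:E <-> vanishes_beyond M (fun _ => c) t.
Proof.
rewrite bigmaxe_le; split=> h i it.
  move=> d cd nz; have /max_int_le hi := h i it.
  by have := hi d nz; rewrite leNgt cd.
apply/max_int_le => d nz; rewrite leNgt; apply/negP => cd; exact: (h i it d cd).
Qed.

Lemma reg_upto_le (M : gradedModule k n) t c :
  reg_upto M t <= c%:E <-> vanishes_beyond M (fun i => c - i%:Z)%R t.
Proof.
have shift (x : \bar int) (i : int) : x + i%:E <= c%:E <-> x <= (c - i)%R%:E.
  by case: x => [r| |]; rewrite /= -?EFinD ?lee_fin ?lerBrDr ?leye_eq ?leNye.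
rewrite /reg_upto (bigmaxe_le (fun i => a_inv M i + i%:Z%:E)); split=> h i it.
  move=> d cd nz; have /shift /max_int_le hi := h i it.
  by have := hi d nz; rewrite leNgt cd.
apply/shift/max_int_le => d nz; rewrite leNgt; apply/negP => cd; exact: (h i it d cd).
Qed.

End Invariants.

Lemma gin_vanishes_beyond (k : fieldType) (n : nat)
    (k_infinite : forall s : seq k, exists x : k, x \notin s)
    (I J : homogIdeal k n) (gin_IJ : is_gin (hideal_set I) (hideal_set J))
    (t : nat) (le_tn : (t <= n)%N) (c : nat -> int) (hc : forall i, c i <= c i.+1 + 1) :
  vanishes_beyond (ideal_module I) c t <-> vanishes_beyond (ideal_module J) c t.
Proof.
have [_ [U [Uopen U0 hU]]] := gin_IJ.
have [g [ug [Ug [D hD]]]] := generic_colon k_infinite I Uopen U0.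
pose I' := gl_image I ug.
have JE : initial_ideal (hideal_set I') = hideal_set J := hU g Ug.
have regI' : exists D : nat, forall j, (j < n)%N -> forall e, (D < e)%N ->
    colon_at (hideal_set I') j e by exists D.
(* Filter-regularity for J is inherited from gI through the equality of colons in each degree, with
   the same D. *)
have regJ : exists D : nat, forall j, (j < n)%N -> forall e, (D < e)%N ->
    colon_at (hideal_set J) j e.
  by exists D => j jn e De; rewrite -JE -initial_colonE //; exact: hD.
have critI := @ideal_lc_criterion k n I I' (gl_mor g) (gl_mor (invmx g)) (gl_morK ug)
  (gl_morVK ug) (@gl_mor_homog k n g) (@gl_mor_homog k n (invmx g)) (gl_imageP I ug)
  c t hc le_tn (regular_large regI').
(* For J the variables themselves are filter-regular, so the coordinate change is the identity. *)
have critJ := @ideal_lc_criterion k n J J idfun idfun (fun _ => erefl) (fun _ => erefl)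
  (fun _ _ h => h) (fun _ _ h => h) (fun _ => iff_refl _)
  c t hc le_tn (regular_large regJ).
rewrite /vanishes_beyond critI critJ !colon_criterion //.
split=> -[h1 h2]; split=> [l ln lt e ce|tE cn].
- by rewrite -JE -initial_colonE //; exact: h1.
- by have /initial_eq0 := h2 tE cn; rewrite JE.
- by rewrite initial_colonE // JE; exact: h1.
- by apply/initial_eq0; rewrite JE; exact: h2.
Qed.

Unset Implicit Arguments.
Local Close Scope ring_scope.
Local Close Scope classical_set_scope.

(* k is infinite, as for a finite k a Gin defined through Zariski open subsets
   of GL(n,k) is not unique. *)
Theorem corollary1p4 (k : fieldType) (n : nat)
    (k_infinite : forall s : seq k, exists x : k, x \notin s)
    (I J : homogIdeal k n) (gin_IJ : is_gin I J) (t : nat) (le_tn : t <= n) :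
  reg_upto (ideal_module I) t = reg_upto (ideal_module J) t /\
  a_star (ideal_module I) t = a_star (ideal_module J) t.
Proof.
split; apply: ereal_int_eq => c.
  by rewrite !reg_upto_le; apply: gin_vanishes_beyond => // i; lia.
by rewrite !a_star_le; apply: gin_vanishes_beyond => // i; rewrite lerDl.
Qed.
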